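(* Let $X$ be a uniformly locally finite metric space. Then $X$ is both Roe rigid and uniform Roe rigid if any one of the following conditions holds: (1) $X$ is sparse, admits a fibred coarse embedding into a Hilbert space, and satisfies the coarse Baum-Connes conjecture. (2) $X=\Box\Gamma$ is the box space of a residually finite, finitely generated discrete group $\Gamma$ that admits a coarse embedding into a Banach space with property (H), and $X$ satisfies the coarse Baum-Connes conjecture. (3) $X=\Gamma$ is a countable discrete group (equipped with a proper left-invariant metric) which satisfies the Baum-Connes conjecture with coefficients.
   Context: A metric space $(X,d)$ is uniformly locally finite (u.l.f.) if $\sup_{x\in X}|\{y\in X: d(x,y)\le r\}|<\infty$ for all $r>0$, and uniformly discrete if $\inf_{x\ne y}d(x,y)>0$. Coarse notions. A map $f:(X,d)\to(Y,\partial)$ is coarse if for all $s>0$ there is $r>0$ such that $d(x,y)<s$ implies $\partial(f(x),f(y))<r$; it is expanding if for all $r>0$ there is $s>0$ such that $d(x,y)>s$ implies $\partial(f(x),f(y))>r$. It is a coarse embedding if it is both, and a coarse equivalence if in addition $\sup_{y\in Y}\partial(y,f(X))<\infty$. $X$ and $Y$ are (bijectively) coarsely equivalent if there is a (bijective) coarse equivalence $X\to Y$. Roe algebras. Fix an infinite dimensional separable Hilbert space $H_X$. For $a\in\mathcal B(\ell_2(X,H_X))$ let $a_{xy}=e_{yy}ae_{xx}\in\mathcal B(H_X)$, where $e_{xx}$ is the projection onto $\delta_x\otimes H_X$, and let $\mathrm{prop}(a)=\sup\{d(x,y):a_{xy}\neq0\}$. The Roe algebra $\mathrm{C}^*(X)$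 is the norm closure of the set of all $a$ with $\mathrm{prop}(a)<\infty$ and all $a_{xy}$ compact. The uniform Roe algebra $\mathrm{C}^*_u(X)$ is the norm closure of the finite propagation operators in $\mathcal B(\ell_2(X))$. A u.l.f. metric space $X$ is Roe rigid (resp. uniform Roe rigid) if $X$ is coarsely equivalent to every u.l.f. metric space $Y$ such that $\mathrm{C}^*(X)$ and $\mathrm{C}^*(Y)$ (resp. $\mathrm{C}^*_u(X)$ and $\mathrm{C}^*_u(Y)$) are $*$-isomorphic. Sparse. $X$ is sparse if there is a partition $X=\bigsqcup_{n\in\mathbb N}X_n$ into finite (possibly empty) sets with $d(X_n,X_m)\to\infty$ as $n+m\to\infty$, $n\ne m$. Fibred coarse embedding. $X$ admits a fibred coarse embedding into a Hilbert space $H$ if there exist a field of Hilbert spaces $(H_x)_{x\in X}$, a section $s$ with $s(x)\in H_x$ for all $x$, and nondecreasing functions $\rho_1,\rho_2:[0,\infty)\to(-\infty,\infty)$ with $\lim_{t\to\infty}\rho_i(t)=\infty$, such that for every $r>0$ there is a bounded $K\subset X$ so that for each $C\subset X\setminus K$ of diameter less than $r$ there are surjective affine isometries $t_C(x):H_x\to H$ ($x\in C$) satisfying: (i) $\rho_1(d(x,y))\le\|t_C(x)(s(x))-t_C(y)(s(y))\|\le\rho_2(d(x,y))$ for all $x,y\in C$; (ii) for any two such $C_1,C_2$ with $C_1\cap C_2\neq\emptyset$ there is an affine isometry $t_{C_1C_2}:H\to H$ with $t_{C_1}(x)\circ t_{C_2}(x)^{-1}=t_{C_1C_2}$ for all $x\in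 C_1\cap C_2$. Box space. For a residually finite, finitely generated group $\Gamma$ and a decreasing sequence $\Gamma_1\supseteq\Gamma_2\supseteq\cdots$ of finite index normal subgroups with trivial intersection, the box space $\Box\Gamma$ is $\bigsqcup_n\Gamma/\Gamma_n$ with a metric which restricts on each $\Gamma/\Gamma_n$ to the quotient of a fixed word metric on $\Gamma$ and for which $d(\Gamma/\Gamma_n,\Gamma/\Gamma_m)\to\infty$ as $n+m\to\infty$, $n\neq m$. Any such box space is allowed. Property (H). A real Banach space $V$ has property (H) if there are an increasing sequence $(V_n)$ of finite dimensional subspaces of $V$ and an increasing sequence $(W_n)$ of finite dimensional subspaces of a real Hilbert space such that $\bigcup_nV_n$ is dense in $V$ and there is a uniformly continuous map $\psi:S(\bigcup_nV_n)\to S(\bigcup_nW_n)$ whose restriction to $S(V_n)$ is a homeomorphism onto $S(W_n)$ for each $n$; $S(\cdot)$ denotes the unit sphere. Baum-Connes for groupoids. Let $G$ be a locally compact, $\sigma$-compact, Hausdorff groupoid with a Haar system, with source $s$ and range $r$. A $G$-C*-algebra is a $C_0(G^{(0)})$-algebra $A$ with an isomorphism $\alpha:s^*A\to r^*A$ of $C_0(G)$-algebras satisfying $\alpha_{gh}=\alpha_g\alpha_h$ for composable $g,h$. Put $K^{top}_*(G,A)=\varinjlim_Z KK^G_*(C_0(Z),A)$ (Le Gall's equivariant KK-theory), the limit being over the $G$-compact $G$-invariant closed subsets $Z$ of a universal proper $G$-space $\underline{E}G$. The assembly map $\mu_{r,A}:K^{top}_*(G,A)\to K_*(A\rtimes_rG)$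 is induced by the composition of the reduced descent $KK^G_*(C_0(Z),A)\to KK_*(C_0(Z)\rtimes_rG,A\rtimes_rG)$ with the Kasparov product by the class in $K_0(C_0(Z)\rtimes_rG)$ of the projection determined by a cutoff function on $Z$. $G$ satisfies the Baum-Connes conjecture for $A$ if $\mu_{r,A}$ is an isomorphism, and the Baum-Connes conjecture with coefficients if this holds for all $G$-C*-algebras $A$. A countable discrete group is a groupoid of this kind, which gives the usual Baum-Connes conjecture with coefficients for groups. Coarse Baum-Connes conjecture. For a u.l.f. metric space $(X,d)$ let $\Delta_R=\{(x,y)\in X\times X:d(x,y)\le R\}$ and $G(X)=\bigcup_{R>0}\overline{\Delta_R}\subset\beta(X\times X)$ (Stone-Čech compactification). The structure maps of the pair groupoid $X\times X$ extend uniquely continuously to $G(X)$, making it a principal, étale, locally compact, $\sigma$-compact Hausdorff groupoid with unit space $\beta X$. There is a second countable étale groupoid $G'$ with $G(X)=\beta X\rtimes G'$, and the assembly map of $G(X)$ with coefficients in $A$ agrees with that of $G'$ with coefficients in $A$. A uniformly discrete u.l.f. metric space $X$ satisfies the coarse Baum-Connes conjecture if $G(X)$ satisfies the Baum-Connes conjecture for $\ell_\infty(X,\mathcal K(\ell_2(\mathbb N)))$, with the canonical action (induced by translation along bounded-distance partial bijections $t:A\to B$ of $X$, $f\mapsto f\circ t^{-1}$). A general u.l.f. metric space satisfies it if it is bijectively coarsely equivalent to a uniformly discrete metric space which satisfies it. *)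

(* Defs.v *)
From HB Require Import structures.
From mathcomp Require Import all_boot all_order all_algebra.
From mathcomp Require Import complex finmap.
From mathcomp Require Import all_classical all_reals all_analysis.
From mathcomp Require Import summability ring lra.

Set Implicit Arguments.
Unset Strict Implicit.
Unset Printing Implicit Defensive.

Import Order.TTheory GRing.Theory Num.Theory numFieldNormedType.Exports.
Local Open Scope classical_set_scope.
Local Open Scope ring_scope.
Local Open Scope complex_scope.

(* The coarse notions are stated for bare distance functions, so that they
   apply both to the canonical metric of a [metricType] and to word metrics. *)

Section Coarse.
Variables (R : realType) (X Y : Type) (dX : X -> X -> R) (dY : Y -> Y -> R).
Implicit Type f : X -> Y.

Definition coarse_map f := forall s : R, 0 < s -> exists2 r : R, 0 < r &
  forall x y, dX x y < s -> dY (f x) (f y) < r.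

Definition expanding_map f := forall r : R, 0 < r -> exists2 s : R, 0 < s &
  forall x y, s < dX x y -> r < dY (f x) (f y).

Definition coarse_embedding f := coarse_map f /\ expanding_map f.

Definition coarse_equivalence f :=
  coarse_embedding f /\ exists c : R, forall y, exists x, dY y (f x) <= c.

End Coarse.

Section Metric.
Variable R : realType.

Definition coarsely_equivalent (X Y : metricType R) :=
  exists f : X -> Y, coarse_equivalence (@mdist R X) (@mdist R Y) f.

Definition bijectively_coarsely_equivalent (X Y : metricType R) :=
  exists2 f : X -> Y, bijective f &
    coarse_equivalence (@mdist R X) (@mdist R Y) f.

Definition ulf (X : metricType R) := forall r : R, 0 < r ->
  exists N : nat, forall x : X, ([set y | mdist x y <= r] #<= `I_N)%card.

Definition uniformly_discrete (X : metricType R) :=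
  exists2 c : R, 0 < c & forall x y : X, x != y -> c <= mdist x y.

(* [d(X_n, X_m) -> oo] as [n + m -> oo], [n <> m]; empty blocks impose
   nothing. *)
Definition blocks_diverge (X : metricType R) (B : nat -> set X) :=
  forall M : R, exists N : nat, forall n m : nat, n != m -> (N <= n + m)%N ->
    forall x y, B n x -> B m y -> M <= mdist x y.

Definition sparse (X : metricType R) := exists B : nat -> set X,
  [/\ forall n, finite_set (B n), trivIset setT B, \bigcup_n B n = setT &
      blocks_diverge B].

End Metric.

Section Ell2Space.
Variables (R : realType) (I : choiceType).
Local Notation C := R[i].

Definition sqmod (z : C) : R := complex.Re z ^+ 2 + complex.Im z ^+ 2.

Definition l2sum (xi : I -> C) : \bar R :=
  \esum_(i in [set: I]) (sqmod (xi i))%:E.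

Definition ell2_pred : {pred I -> C} := fun xi => (l2sum xi < +oo)%E.

Lemma sqmod_ge0 z : 0 <= sqmod z.
Proof. by rewrite addr_ge0 ?sqr_ge0. Qed.

Lemma sqmodD z w : sqmod (z + w) <= 2 * sqmod z + 2 * sqmod w.
Proof.
case: z w => a b [c d]; rewrite /sqmod /=.
have := addr_ge0 (sqr_ge0 (a - c)) (sqr_ge0 (b - d)).
by rewrite -subr_ge0 => ?; rewrite -subr_ge0; lra.
Qed.

Lemma sqmodM z w : sqmod (z * w) = sqmod z * sqmod w.
Proof. by case: z w => a b [c d]; rewrite /sqmod /=; ring. Qed.

Lemma ell2P (xi : I -> C) :
  reflect (exists M : R, forall A : set I, finite_set A ->
    (\sum_(i \in A) (sqmod (xi i))%:E <= M%:E)%E) (xi \in ell2_pred).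
Proof.
apply: (iffP idP); rewrite /in_mem /= /ell2_pred /l2sum.
  move=> lt; exists (fine (l2sum xi)) => A finA.
  rewrite fineK; last by rewrite ge0_fin_numE // esum_ge0 // => i _;
    rewrite lee_fin sqmod_ge0.
  by apply: esum_ge; exists A => //; split.
move=> [M h]; apply: (@le_lt_trans _ _ M%:E); last exact: ltry.
by apply: ge_ereal_sup => _ [A [finA _]] <-; apply: h.
Qed.

Lemma ell2_submod : submod_closed ell2_pred.
Proof.
split.
  apply/ell2P; exists 0 => A finA; rewrite fsbig1 // => i _.
  by rewrite /sqmod /= expr0n addr0.
move=> k xi eta /ell2P[M hM] /ell2P[N hN]; apply/ell2P.
exists (2 * (sqmod k * M) + 2 * N) => A finA.
apply: (@le_trans _ _
  (\sum_(i \in A) (2 * (sqmod k * sqmod (xi i)) + 2 * sqmod (eta i))%:E)%E).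
  by apply: lee_fsum => // i _; rewrite lee_fin -sqmodM; exact: sqmodD.
move: (hM A finA) (hN A finA); rewrite !fsumEFin // !lee_fin => hM' hN'.
by rewrite fsbig_split //= -!mulr_fsumr lerD // !ler_wpM2l ?sqmod_ge0.
Qed.

Lemma ell2_mask (A : set I) (xi : I -> C) : xi \in ell2_pred ->
  (fun i => if i \in A then xi i else 0) \in ell2_pred.
Proof.
move=> /ell2P[M hM]; apply/ell2P; exists M => B finB.
apply: le_trans (hM B finB); apply: lee_fsum => // i _; rewrite lee_fin.
by case: ifP => // _; rewrite {1}/sqmod /= expr0n addr0 sqmod_ge0.
Qed.

HB.instance Definition _ := GRing.isSubmodClosed.Build C (I -> C) ell2_pred
  ell2_submod.

Record ell2 := Ell2 { ell2_fun :> I -> C; _ : ell2_fun \in ell2_pred }.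

HB.instance Definition _ := [isSub for ell2_fun].
HB.instance Definition _ := [Choice of ell2 by <:].
HB.instance Definition _ := [SubChoice_isSubLmodule of ell2 by <:].

Lemma ell2_funP (xi : ell2) : (xi : I -> C) \in ell2_pred.
Proof. by case: xi. Qed.

Definition l2norm (xi : ell2) : R := Num.sqrt (fine (l2sum xi)).

(* Linear in the first variable; the sum is the limit over finite subsets. *)
Definition l2dot (xi eta : ell2) : C :=
  summability.sum (fun i => xi i * (eta i)^* : C^o).

(* The orthogonal projection onto the vectors supported in [A]. *)
Definition mask (A : set I) (xi : ell2) : ell2 :=
  Ell2 (ell2_mask A (ell2_funP xi)).

(* Elements of [B(ell2)] are functions [ell2 -> ell2] satisfying [bounded_op]. *)
Definition bounded_op (a : ell2 -> ell2) := linear a /\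
  exists M : R, forall xi, l2norm (a xi) <= M * l2norm xi.

(* The image of the unit ball is totally bounded, i.e. relatively compact. *)
Definition compact_op (a : ell2 -> ell2) := bounded_op a /\
  forall e : R, 0 < e -> exists s : seq ell2, forall xi, l2norm xi <= 1 ->
    exists2 eta, eta \in s & l2norm (a xi - eta) <= e.

Definition op_closure (S : set (ell2 -> ell2)) : set (ell2 -> ell2) :=
  [set a | bounded_op a /\ forall e : R, 0 < e ->
    exists2 b, S b & forall xi, l2norm (a xi - b xi) <= e * l2norm xi].

Definition adjoint_ops (a b : ell2 -> ell2) :=
  forall xi eta, l2dot (a xi) eta = l2dot xi (b eta).

End Ell2Space.

(* [A] and [B] are *-algebras of bounded operators. *)
Definition star_isomorphic (R : realType) (I J : choiceType)
    (A : set (ell2 R I -> ell2 R I)) (B : set (ell2 R J -> ell2 R J)) :=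
  exists Phi : (ell2 R I -> ell2 R I) -> (ell2 R J -> ell2 R J),
  [/\ set_bij A B Phi,
      forall (k : R[i]) a b, A a -> A b ->
        Phi (fun xi => k *: a xi + b xi) = fun eta => k *: Phi a eta + Phi b eta,
      forall a b, A a -> A b -> Phi (a \o b) = Phi a \o Phi b &
      forall a b, A a -> A b -> adjoint_ops a b -> adjoint_ops (Phi a) (Phi b)].

Section Roe.
Variables (R : realType) (X : metricType R).

(* The entry [a_xy = e_yy a e_xx], for an index set fibred over [X] by [p];
   [e_xx] is the projection onto the vectors supported in the fibre at [x]. *)
Definition op_entry (I : choiceType) (p : I -> X) (a : ell2 R I -> ell2 R I)
    (x y : X) : ell2 R I -> ell2 R I :=
  mask (p @^-1` [set y]) \o a \o mask (p @^-1` [set x]).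

Definition finite_propagation (I : choiceType) (p : I -> X)
    (a : ell2 R I -> ell2 R I) :=
  exists r : R, forall x y, op_entry p a x y <> (fun=> 0) -> mdist x y <= r.

(* [H_X] is taken to be [ell2 nat], so that [l2(X, H_X)] is [ell2 (X * nat)]
   and [delta_x (x) H_X] consists of the vectors supported in [{x} * nat]. *)
Definition roe_algebra : set (ell2 R (X * nat)%type -> ell2 R (X * nat)%type) :=
  op_closure [set a | [/\ bounded_op a, finite_propagation fst a &
    forall x y, compact_op (op_entry fst a x y)]].

Definition uniform_roe_algebra : set (ell2 R X -> ell2 R X) :=
  op_closure [set a | bounded_op a /\ finite_propagation id a].

End Roe.

Section Rigidity.
Variable R : realType.

Definition roe_rigid (X : metricType R) := forall Y : metricType R, ulf Y ->
  star_isomorphic (roe_algebra (X := X)) (roe_algebra (X := Y)) ->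
  coarsely_equivalent X Y.

Definition uniform_roe_rigid (X : metricType R) :=
  forall Y : metricType R, ulf Y ->
  star_isomorphic (uniform_roe_algebra (X := X)) (uniform_roe_algebra (X := Y)) ->
  coarsely_equivalent X Y.

End Rigidity.

Section Embeddings.
Variable R : realType.

Definition hilbert_norm (H : normedModType R) := exists ip : H -> H -> R,
  [/\ forall x y, ip x y = ip y x,
      forall k x y z, ip (k *: x + y) z = k * ip x z + ip y z &
      forall x, ip x x = `|x| ^+ 2].

Definition affine_isometry (U V : normedModType R) (t : U -> V) :=
  exists (L : U -> V) (v : V),
    [/\ linear L, forall u, `|L u| = `|u| & forall u, t u = L u + v].

Definition diam_lt (X : metricType R) (A : set X) (r : R) :=
  exists2 r' : R, r' < r & forall x y, A x -> A y -> mdist x y <= r'.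

Definition bounded_subset (X : metricType R) (A : set X) :=
  exists r : R, diam_lt A r.

Definition fibred_coarse_embedding (X : metricType R) :=
  exists (H : completeNormedModType R) (Hx : X -> completeNormedModType R)
    (s : forall x, Hx x) (rho1 rho2 : R -> R),
  [/\ hilbert_norm H /\ (forall x, hilbert_norm (Hx x)),
      (forall a b, 0 <= a -> a <= b -> rho1 a <= rho1 b /\ rho2 a <= rho2 b),
      (rho1 a @[a --> +oo] --> +oo) /\ (rho2 a @[a --> +oo] --> +oo) &
      forall r : R, 0 < r -> exists2 K : set X, bounded_subset K &
      exists t : set X -> forall x, Hx x -> H,
      let adm (D : set X) := D `<=` ~` K /\ diam_lt D r in
      [/\ forall D, adm D -> forall x, D x ->
            affine_isometry (t D x) /\ (forall v, exists u, t D x u = v),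
          forall D, adm D -> forall x y, D x -> D y ->
            rho1 (mdist x y) <= `|t D x (s x) - t D y (s y)| <= rho2 (mdist x y) &
          forall D1 D2, adm D1 -> adm D2 -> D1 `&` D2 !=set0 ->
            exists2 t12 : H -> H, affine_isometry t12 &
            forall x, D1 x -> D2 x -> forall u, t D1 x u = t12 (t D2 x u)]].

Definition fin_dim_subspace (V : lmodType R) (A : set V) :=
  exists (n : nat) (e : 'I_n -> V),
    A = [set v | exists c : 'I_n -> R, v = \sum_i c i *: e i].

Definition unit_sphere (V : normedModType R) (A : set V) : set V :=
  [set v | A v /\ `|v| = 1].

Definition property_H (V : completeNormedModType R) :=
  exists (W : completeNormedModType R) (Vn : nat -> set V) (Wn : nat -> set W)
    (psi : V -> W),
  [/\ hilbert_norm W,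
      forall n, [/\ fin_dim_subspace (Vn n), fin_dim_subspace (Wn n),
                    Vn n `<=` Vn n.+1 & Wn n `<=` Wn n.+1],
      closure (\bigcup_n Vn n) = setT,
      (forall e : R, 0 < e -> exists2 d : R, 0 < d & forall u v,
         unit_sphere (\bigcup_n Vn n) u -> unit_sphere (\bigcup_n Vn n) v ->
         `|u - v| < d -> `|psi u - psi v| < e) &
      forall n, [/\ set_bij (unit_sphere (Vn n)) (unit_sphere (Wn n)) psi,
        {within unit_sphere (Vn n), continuous psi} &
        exists2 phi : W -> V, {within unit_sphere (Wn n), continuous phi} &
          forall v, unit_sphere (Vn n) v -> phi (psi v) = v]].

End Embeddings.

Section BoxSpaces.
Variables (R : realType) (Gamma : groupType).
Local Open Scope group_scope.

Definition word_length_at_most (S : set Gamma) (n : nat) (g : Gamma) :=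
  exists w : seq Gamma, [/\ (size w <= n)%N,
    forall s, s \in w -> S s \/ S s^-1 & g = \prod_(s <- w) s].

Definition finite_generating (S : set Gamma) :=
  finite_set S /\ forall g, exists n, word_length_at_most S n g.

Definition word_dist (S : set Gamma) (g h : Gamma) : R :=
  inf [set n%:R%R | n in [set n | word_length_at_most S n (g^-1 * h)]].

Definition finite_index_normal (N : set Gamma) :=
  [/\ N 1, forall g h, N g -> N h -> N (g * h^-1),
      forall g h, N g -> N (h^-1 * g * h) &
      exists2 T : set Gamma, finite_set T &
        forall g, exists2 t, T t & N (t^-1 * g)].

Definition residually_finite := forall g : Gamma, g <> 1 ->
  exists2 N, finite_index_normal N & ~ N g.

(* [X] is the box space of [Gamma]: [p n g] is the coset of [g] in the block
   [Gamma / N n]. *)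
Definition is_box_space (S : set Gamma) (N : nat -> set Gamma)
    (X : metricType R) := exists p : nat -> Gamma -> X,
  [/\ forall n, finite_index_normal (N n) /\ N n.+1 `<=` N n,
      \bigcap_n N n = [set 1],
      (forall x, exists n g, p n g = x) /\
      (forall n m g h, p n g = p m h <-> n = m /\ N n (g^-1 * h)),
      forall n g h, mdist (p n g) (p n h) =
        inf [set word_dist S (g * a) (h * b) | a in N n & b in N n] &
      blocks_diverge (fun n => range (p n))].

End BoxSpaces.

(* The data of an etale groupoid; [gmul g h] is meaningful when
   [gsrc g = grng h].  The groupoids used below are the one attached to a
   metric space, countable discrete groups and the trivial groupoid; all of
   them are locally compact, sigma-compact, Hausdorff and etale.  The Haar
   system is the one of counting measures on the fibres of [grng]. *)
Record groupoid := Groupoid {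
  gobj : topologicalType;
  garr : topologicalType;
  gsrc : garr -> gobj;
  grng : garr -> gobj;
  gmul : garr -> garr -> garr;
  ginv : garr -> garr;
  gunit : gobj -> garr }.

Definition trivial_groupoid : groupoid :=
  @Groupoid (discrete_topology unit) (discrete_topology unit)
    id id (fun _ _ => tt) id id.

Definition group_groupoid (Gamma : groupType) : groupoid :=
  @Groupoid (discrete_topology unit) (discrete_topology Gamma)
    (fun=> tt) (fun=> tt) (fun g h : Gamma => (g * h)%g)
    (fun g : Gamma => (g^-1)%g) (fun=> (1%g : Gamma)).

(* The Stone-Cech compactification of the discrete space [T]. *)
Section Beta.
Variable T : Type.

Record beta := Beta {
  beta_sets :> set_system T;
  beta_ultra : UltraFilter beta_sets }.

HB.instance Definition _ := gen_eqMixin beta.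
HB.instance Definition _ := gen_choiceMixin beta.
HB.instance Definition _ := @isSubBaseTopological.Build beta
  (set T) setT (fun A : set T => [set w : beta | beta_sets w A]).

Definition beta_pure (x : T) : beta := Beta (principal_filter_ultra x).

End Beta.

Lemma ultra_fmap (T U : Type) (f : T -> U) (F : set_system T) :
  UltraFilter F -> UltraFilter [set A | F (f @^-1` A)].
Proof.
move=> FU.
have FF : Filter [set A | F (f @^-1` A)].
  split => [|A B FA FB|A B AB FA] /=.
  - exact: (@filterT _ F).
  - exact: (@filterI _ F).
  - by apply: (@filterS _ F) FA => x; exact: AB.
split.
  apply: Build_ProperFilter_ex => A FA.
  by have [x] := @filter_ex _ F _ _ FA; exists (f x).
move=> G GF FG; rewrite eqEsubset; split=> // A GA.
have [//|FnA] := in_ultra_setVsetC (f @^-1` A) FU.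
have GnA : G (~` A) by exact: FG.
by have [x []] := @filter_ex _ G _ _ (@filterI _ G _ _ _ GA GnA).
Qed.

Definition beta_map (T U : Type) (f : T -> U) (w : beta T) : beta U :=
  Beta (ultra_fmap f (beta_ultra w)).

(* The groupoid [G(X)].  Its arrows are the ultrafilters on [X * X] that
   contain some [Delta_R]: the set of ultrafilters containing [A] is the
   closure of [A] in [beta (X * X)]. *)
Section CoarseGroupoid.
Variables (R : realType) (X : metricType R).

Definition Delta (r : R) : set (X * X) := [set u | mdist u.1 u.2 <= r].

Definition coarse_arrows : set (beta (X * X)) :=
  [set w : beta (X * X) | exists r, beta_sets w (Delta r)].

Lemma coarse_arrows_inv (w : beta (X * X)) : coarse_arrows w ->
  coarse_arrows (beta_map (fun u => (u.2, u.1)) w).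
Proof.
move=> [r wr]; exists r => /=; have := @beta_ultra _ w => wU.
by apply: filterS wr => -[x y]; rewrite /Delta /= metric_sym.
Qed.

Lemma coarse_arrows_unit (w : beta X) :
  coarse_arrows (beta_map (fun x => (x, x)) w).
Proof.
exists 0 => /=; have := @beta_ultra _ w => wU.
by apply: filterE => x; rewrite /Delta /= mdistxx.
Qed.

(* [(x, y)] has range [x] and source [y]. *)
Definition coarse_src (g : coarse_arrows) : beta X := beta_map snd (\val g).
Definition coarse_rng (g : coarse_arrows) : beta X := beta_map fst (\val g).

Definition rel_comp (A B : set (X * X)) : set (X * X) :=
  [set u | exists y, A (u.1, y) /\ B (y, u.2)].

(* The continuous extension of [(x, y) (y, z) = (x, z)]: the product of two
   composable arrows [g], [h] is the only arrow that contains every composite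
   of a set in [g] with a set in [h]; the choice [g] for non-composable pairs
   is irrelevant. *)
Definition coarse_mul (g h : coarse_arrows) : coarse_arrows :=
  xget g [set k : coarse_arrows | forall A B,
    beta_sets (\val g) A -> beta_sets (\val h) B ->
    beta_sets (\val k) (rel_comp A B)].

Definition coarse_inv (g : coarse_arrows) : coarse_arrows :=
  SigSub (mem_set (coarse_arrows_inv (set_valP g))).

Definition coarse_unit (w : beta X) : coarse_arrows :=
  SigSub (mem_set (coarse_arrows_unit w)).

Definition coarse_groupoid : groupoid :=
  @Groupoid (beta X) coarse_arrows
    coarse_src coarse_rng coarse_mul coarse_inv coarse_unit.

End CoarseGroupoid.

Section CStar.
Variable R : realType.
Local Notation C := R[i].

(* The norm of a complex normed module is [C]-valued; this is its value as a
   real number. *)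
Definition nrm (E : normedModType C) (x : E) : R := complex.Re `|x|.

Record cstar := CStar {
  cs_car :> completeNormedModType C;
  cs_mul : cs_car -> cs_car -> cs_car;
  cs_star : cs_car -> cs_car;
  cs_mulA : forall a b c, cs_mul a (cs_mul b c) = cs_mul (cs_mul a b) c;
  cs_mul_linear_l : forall k a b c,
    cs_mul (k *: a + b) c = k *: cs_mul a c + cs_mul b c;
  cs_mul_linear_r : forall k a b c,
    cs_mul a (k *: b + c) = k *: cs_mul a b + cs_mul a c;
  cs_starD : forall k a b, cs_star (k *: a + b) = k^* *: cs_star a + cs_star b;
  cs_starK : forall a, cs_star (cs_star a) = a;
  cs_starM : forall a b, cs_star (cs_mul a b) = cs_mul (cs_star b) (cs_star a);
  cs_norm_mul : forall a b, nrm (cs_mul a b) <= nrm a * nrm b;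
  cs_norm_star : forall a, nrm (cs_mul (cs_star a) a) = nrm a ^+ 2 }.

(* The restriction of [f] to [Z] belongs to [C_0(Z)].  Functions on a subset
   [Z] are represented by functions on the ambient space; their values outside
   of [Z] are irrelevant. *)
Definition C0 (T : topologicalType) (Z : set T) (f : T -> C^o) :=
  {within Z, continuous f} /\
  forall e : R, 0 < e -> compact (Z `&` [set z | e <= nrm (f z)]).

(* Right Hilbert [A]-modules; the inner product is linear in the second
   variable. *)
Record hmod (A : cstar) := HMod {
  hm_car :> completeNormedModType C;
  hm_mul : hm_car -> A -> hm_car;
  hm_ip : hm_car -> hm_car -> A;
  hm_mul_linear_l : forall k x y a,
    hm_mul (k *: x + y) a = k *: hm_mul x a + hm_mul y a;
  hm_mul_linear_r : forall k x a b,
    hm_mul x (k *: a + b) = k *: hm_mul x a + hm_mul x b;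
  hm_mulA : forall x a b, hm_mul x (cs_mul a b) = hm_mul (hm_mul x a) b;
  hm_ip_linear : forall k x y z,
    hm_ip x (k *: y + z) = k *: hm_ip x y + hm_ip x z;
  hm_ip_mul : forall x y a, hm_ip x (hm_mul y a) = cs_mul (hm_ip x y) a;
  hm_ip_star : forall x y, cs_star (hm_ip x y) = hm_ip y x;
  hm_ip_ge0 : forall x, exists a, hm_ip x x = cs_mul (cs_star a) a;
  hm_norm : forall x, nrm x ^+ 2 = nrm (hm_ip x x) }.

Section Operators.
Variables (A : cstar) (E : hmod A).

Definition hm_adjoint (S T : E -> E) :=
  forall x y, hm_ip (S x) y = hm_ip x (T y).

(* [T] belongs to [K(E)], the closed span of the rank one operators
   [x |-> u <v, x>]. *)
Definition hm_compact (T : E -> E) := forall e : R, 0 < e ->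
  exists (n : nat) (u v : 'I_n -> E), forall x,
    nrm (T x - \sum_i hm_mul (u i) (hm_ip (v i) x)) <= e * nrm x.

Definition hm_countably_generated := exists u : nat -> E,
  forall x (e : R), 0 < e ->
    exists (n : nat) (a : 'I_n -> A), nrm (x - \sum_(i < n) hm_mul (u i) (a i)) < e.

End Operators.

Section GroupoidActions.
Variable G : groupoid.

(* Data of a [G]-C*-algebra: the [C_0(G^(0))]-module structure [ga_mod] and
   the action, [ga_act g a] being a representative in [A] of the element
   [alpha_g (a (s g))] of the fibre [A_(r g)]. *)
Record galg := GAlg {
  ga_alg :> cstar;
  ga_mod : (gobj G -> C^o) -> ga_alg -> ga_alg;
  ga_act : garr G -> ga_alg -> ga_alg }.

(* [A_y] is the quotient of [A] by the ideal [C_0(G^(0) \ y) A], whose elements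
   are products [phi b] with [phi y = 0] (Cohen factorization); thus [fib_lt]
   says that the quotient norm of [a (y)] is less than [e]. *)
Definition fib_lt (A : galg) (y : gobj G) (a : A) (e : R) :=
  exists phi b, [/\ C0 setT phi, phi y = 0 & nrm (a - ga_mod phi b) < e].

Definition fib_eq (A : galg) (y : gobj G) (a b : A) :=
  forall e : R, 0 < e -> fib_lt y (a - b) e.

(* [f] represents an element of the pullback [pi^* M = C_0(G) (x) M] of a
   [C_0(G^(0))]-module [M], where [lt y] is the norm of the fibre at [y]: a
   section that is a uniform limit of sums of [g |-> phi g *: m (pi g)] with
   [phi] in [C_0(G)]. *)
Definition pullback_section (M : lmodType C) (lt : gobj G -> M -> R -> Prop)
    (pi : garr G -> gobj G) (f : garr G -> M) :=
  forall e : R, 0 < e ->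
    exists (n : nat) (phi : 'I_n -> garr G -> C^o) (m : 'I_n -> M),
      (forall i, C0 setT (phi i)) /\
      forall g, lt (pi g) (f g - \sum_i (phi i g : C) *: m i) e.

Definition is_galg (A : galg) :=
  [/\ [/\ forall phi a b k, C0 setT phi ->
            ga_mod phi (k *: a + b : A) = k *: ga_mod phi a + ga_mod phi b,
          forall phi psi a k, C0 setT phi -> C0 setT psi ->
            ga_mod (fun y => k * phi y + psi y) a =
            k *: ga_mod phi a + ga_mod psi a :> A,
          forall phi psi a, C0 setT phi -> C0 setT psi ->
            ga_mod (fun y => phi y * psi y) a = ga_mod phi (ga_mod psi a) :> A &
          forall a : A, forall e : R, 0 < e -> exists phi b, C0 setT phi /\
            nrm (a - ga_mod phi b) < e],
      [/\ forall phi (a b : A), C0 setT phi ->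
            ga_mod phi (cs_mul a b) = cs_mul (ga_mod phi a) b,
          forall phi (a b : A), C0 setT phi ->
            ga_mod phi (cs_mul a b) = cs_mul a (ga_mod phi b) &
          forall phi (a : A), C0 setT phi ->
            cs_star (ga_mod phi a) = ga_mod (fun y => (phi y)^*) (cs_star a)],
      forall g, [/\ forall k (a b : A), fib_eq (grng g)
            (ga_act g (k *: a + b)) (k *: ga_act g a + ga_act g b),
          forall a b : A, fib_eq (grng g)
            (ga_act g (cs_mul a b)) (cs_mul (ga_act g a) (ga_act g b)),
          forall a : A, fib_eq (grng g)
            (ga_act g (cs_star a)) (cs_star (ga_act g a)) &
          forall (a : A) (e : R),
            fib_lt (grng g) (ga_act g a) e <-> fib_lt (gsrc g) a e],
      (* [alpha] maps [s^* A] onto [r^* A] *)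
      (forall f : garr G -> A, pullback_section (@fib_lt A) (@gsrc G) f ->
         pullback_section (@fib_lt A) (@grng G) (fun g => ga_act g (f g))) /\
      (forall f : garr G -> A, pullback_section (@fib_lt A) (@grng G) f ->
         exists2 f', pullback_section (@fib_lt A) (@gsrc G) f' &
           forall g, fib_eq (grng g) (ga_act g (f' g)) (f g)) &
      forall g h (a : A), gsrc g = grng h ->
        fib_eq (grng g) (ga_act (gmul g h) a) (ga_act g (ga_act h a))].

(* Data of a [G]-equivariant Hilbert module [E]; as above, [ge_act g x] is a
   representative of [V_g (x (s g))] in [E_(r g)], where [V : s^* E -> r^* E]
   and [E_y = E (x)_A A_y]. *)
Record ghmod (A : galg) := GHMod {
  ge_mod :> hmod A;
  ge_act : garr G -> ge_mod -> ge_mod }.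

Definition efib_lt (A : galg) (E : hmod A) (y : gobj G) (x : E) (e : R) :=
  0 < e /\ fib_lt y (hm_ip x x : A) (e ^+ 2).

Definition efib_eq (A : galg) (E : hmod A) (y : gobj G) (x x' : E) :=
  forall e : R, 0 < e -> efib_lt y (x - x') e.

Definition is_ghmod (A : galg) (E : ghmod A) :=
  [/\ forall g, [/\ forall k (x y : E), efib_eq (grng g)
            (ge_act g (k *: x + y)) (k *: ge_act g x + ge_act g y),
          forall (x : E) (a : A), efib_eq (grng g)
            (ge_act g (hm_mul x a)) (hm_mul (ge_act g x) (ga_act g a)) &
          forall x y : E, fib_eq (grng g)
            (hm_ip (ge_act g x) (ge_act g y)) (ga_act g (hm_ip x y))],
      forall f : garr G -> E, pullback_section (@efib_lt A E) (@gsrc G) f ->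
        pullback_section (@efib_lt A E) (@grng G) (fun g => ge_act g (f g)),
      forall f : garr G -> E, pullback_section (@efib_lt A E) (@grng G) f ->
        exists2 f', pullback_section (@efib_lt A E) (@gsrc G) f' &
          forall g, efib_eq (grng g) (ge_act g (f' g)) (f g) &
      forall g h (x : E), gsrc g = grng h ->
        efib_eq (grng g) (ge_act (gmul g h) x) (ge_act g (ge_act h x))].

(* Data of a left [G]-space; [gs_act g z] is meaningful when
   [gsrc g = gs_anchor z]. *)
Record gspace := GSpace {
  gs_car :> topologicalType;
  gs_anchor : gs_car -> gobj G;
  gs_act : garr G -> gs_car -> gs_car }.

Definition sigma_compact (T : topologicalType) :=
  exists K : nat -> set T, (forall n, compact (K n)) /\ \bigcup_n K n = setT.

Definition gs_dom (Z : gspace) : set (garr G * Z) :=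
  [set p | gsrc p.1 = gs_anchor p.2].

Definition is_proper_gspace (Z : gspace) :=
  [/\ [/\ hausdorff_space Z, locally_compact [set: Z] & sigma_compact Z],
      continuous (@gs_anchor Z) /\
      {within @gs_dom Z, continuous (fun p : garr G * Z => gs_act p.1 p.2)},
      [/\ forall g (z : Z), gsrc g = gs_anchor z ->
            gs_anchor (gs_act g z) = grng g,
          forall g h (z : Z), gsrc g = grng h -> gsrc h = gs_anchor z ->
            gs_act (gmul g h) z = gs_act g (gs_act h z) &
          forall z : Z, gs_act (gunit (gs_anchor z)) z = z] &
      (* [(g, z) |-> (g z, z)] is proper *)
      forall K : set (Z * Z), compact K ->
        compact (@gs_dom Z `&` [set p | K (gs_act p.1 p.2, p.2)])].

Definition is_gmap (Z Z' : gspace) (f : Z -> Z') :=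
  [/\ continuous f, forall z, gs_anchor (f z) = gs_anchor z &
      forall g z, gsrc g = gs_anchor z -> f (gs_act g z) = gs_act g (f z)].

Definition gmap_homotopic (Z Z' : gspace) (f f' : Z -> Z') :=
  exists H : R -> Z -> Z',
  [/\ {within `[0, 1]%classic `*` setT, continuous (fun p : R * Z => H p.1 p.2)},
      forall t, 0 <= t <= 1 -> is_gmap (H t), H 0 = f & H 1 = f'].

Definition universal_proper (E : gspace) := is_proper_gspace E /\
  forall Z, is_proper_gspace Z ->
    (exists f : Z -> E, is_gmap f) /\
    (forall f f' : Z -> E, is_gmap f -> is_gmap f' -> gmap_homotopic f f').

Definition ginvariant (E : gspace) (Z : set E) :=
  forall g z, gsrc g = gs_anchor z -> Z z -> Z (gs_act g z).

(* Closed invariant subsets with compact quotient: the open subsets of the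
   quotient correspond to the invariant open subsets. *)
Definition gcompact (E : gspace) (Z : set E) :=
  [/\ closed Z, ginvariant Z &
      forall F : set (set E), (forall U, F U -> open U /\ ginvariant U) ->
        Z `<=` \bigcup_(U in F) U -> exists F' : set (set E),
          [/\ finite_set F', F' `<=` F & Z `<=` \bigcup_(U in F') U]].

(* Data of a cycle [(E, pi, F)] together with the grading of [E].  Since
   [cy_rep] acts through the restrictions to [Z] of functions on the ambient
   space [P], the same data represent the image of a cycle for [Z] in the group
   of a larger closed subset [Z']. *)
Record cycle (A : galg) (P : gspace) := Cycle {
  cy_mod :> ghmod A;
  cy_rep : (P -> C^o) -> cy_mod -> cy_mod;
  cy_op : cy_mod -> cy_mod;
  cy_grad : cy_mod -> cy_mod }.

(* [i = false]: cycles for [KK^G_0], with [E] graded by [cy_grad], the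
   representation of degree 0 and the operator of degree 1.  [i = true]:
   ungraded cycles, for [KK^G_1]; [cy_grad] is then ignored. *)
Definition is_cycle (i : bool) (A : galg) (P : gspace) (Z : set P)
    (c : cycle A P) :=
  let rep := @cy_rep A P c in let F := @cy_op A P c in
  let gr := @cy_grad A P c in
  [/\ is_ghmod c /\ hm_countably_generated c,
      [/\ forall f f' (x : c), C0 Z f -> C0 Z f' ->
            (forall z, Z z -> f z = f' z) -> rep f x = rep f' x,
          forall f, C0 Z f -> linear (rep f),
          forall f f' k (x : c), C0 Z f -> C0 Z f' ->
            rep (fun z => k * f z + f' z) x = k *: rep f x + rep f' x,
          forall f f' (x : c), C0 Z f -> C0 Z f' ->
            rep (fun z => f z * f' z) x = rep f (rep f' x) &
          forall f, C0 Z f -> hm_adjoint (rep f) (rep (fun z => (f z)^*))],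
      (forall phi f (x : c) (a : A), C0 setT phi -> C0 Z f ->
         rep (fun z => phi (gs_anchor z) * f z) (hm_mul x a) =
         rep f (hm_mul x (ga_mod phi a))) /\
      (forall g f f' (x : c), C0 Z f -> C0 Z f' ->
         (forall z, Z z -> gsrc g = gs_anchor z -> f' (gs_act g z) = f z) ->
         efib_eq (grng g) (ge_act g (rep f x)) (rep f' (ge_act g x))),
      (exists2 F', hm_adjoint F F' & forall f, C0 Z f ->
         [/\ hm_compact (fun x => rep f (F (F x) - x)),
             hm_compact (fun x => rep f (F x) - F (rep f x)) &
             hm_compact (fun x => rep f (F x - F' x))]) /\
      (* [b (V (s^* F) V^* - r^* F)] lies in [r^* K(E)] for [b] in
         [r^* C_0(Z)]; it suffices to consider the elements
         [b = psi (x) f] *)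
      (forall psi f, C0 setT psi -> C0 Z f -> forall e : R, 0 < e ->
         exists (n : nat) (phi : 'I_n -> garr G -> C^o) (k : 'I_n -> c -> c),
         (forall j, C0 setT (phi j) /\ hm_compact (k j)) /\
         forall g (x : c) (d : R), efib_lt (gsrc g) x d ->
           efib_lt (grng g)
             ((psi g : C) *: rep f (ge_act g (F x) - F (ge_act g x)) -
              \sum_j (phi j g : C) *: k j (ge_act g x)) (e * d)) &
      i = false ->
      [/\ [/\ linear gr, forall x, gr (gr x) = x,
              forall x y, hm_ip (gr x) (gr y) = hm_ip x y &
              forall x a, gr (hm_mul x a) = hm_mul (gr x) a],
          forall f x, C0 Z f -> gr (rep f x) = rep f (gr x),
          forall x, gr (F x) = - F (gr x) &
          forall g x, efib_eq (grng g) (gr (ge_act g x)) (ge_act g (gr x))]].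

(* [B] is the [G]-C*-algebra [C([0, 1], A)], with evaluations [ev]. *)
Definition is_path_algebra (A B : galg) (ev : R -> B -> A) :=
  let I := `[0, 1]%classic : set R in
  [/\ is_galg B,
      [/\ forall t, I t -> linear (ev t),
          forall t a b, I t -> ev t (cs_mul a b) = cs_mul (ev t a) (ev t b) &
          forall t a, I t -> ev t (cs_star a) = cs_star (ev t a)],
      (forall b, {within I, continuous (ev^~ b)}) /\
      (forall f : R -> A, {within I, continuous f} ->
         exists b, forall t, I t -> ev t b = f t),
      forall b (M : R), nrm b <= M <-> forall t, I t -> nrm (ev t b) <= M &
      (forall phi t b, C0 setT phi -> I t ->
         ev t (ga_mod phi b) = ga_mod phi (ev t b)) /\
      (forall g t b, I t ->
         fib_eq (grng g) (ev t (ga_act g b)) (ga_act g (ev t b)))].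

(* [q] exhibits [c'] as the cycle obtained from [c] by extension of scalars
   along [ev : B -> A]: it induces an isomorphism [c (x)_B A = c']. *)
Definition is_pushforward (i : bool) (A B : galg) (P : gspace) (Z : set P)
    (ev : B -> A) (c : cycle B P) (c' : cycle A P) :=
  exists q : c -> c',
  [/\ linear q,
      (forall x y, hm_ip (q x) (q y) = ev (hm_ip x y)) /\
      (forall x b, q (hm_mul x b) = hm_mul (q x) (ev b)),
      forall x' (e : R), 0 < e -> exists (n : nat) (x : 'I_n -> c) (a : 'I_n -> A),
        nrm (x' - \sum_j hm_mul (q (x j)) (a j)) < e,
      (forall f x, C0 Z f -> q (cy_rep f x) = cy_rep f (q x)) /\
      (forall x, q (cy_op x) = cy_op (q x)) &
      (forall g x, efib_eq (grng g) (q (ge_act g x)) (ge_act g (q x))) /\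
      (i = false -> forall x, q (cy_grad x) = cy_grad (q x))].

Definition kk_homotopic (i : bool) (A : galg) (P : gspace) (Z : set P)
    (c0 c1 : cycle A P) :=
  exists (B : galg) (ev : R -> B -> A) (c : cycle B P),
  [/\ is_path_algebra ev, is_cycle i Z c, is_pushforward i Z (ev 0) c c0 &
      is_pushforward i Z (ev 1) c c1].

(* Elements of [Gamma_c(G, r^* M)]. *)
Definition compact_section (M : lmodType C) (lt : gobj G -> M -> R -> Prop)
    (f : garr G -> M) :=
  pullback_section lt (@grng G) f /\
  exists2 K, compact K & forall g, ~ K g -> f g = 0.

Local Notation "h \\ g" := (gmul (ginv h) g) (at level 40, left associativity).

Section CrossedProduct.
Variable A : galg.

Definition compact_asection := compact_section (@fib_lt A).

(* The operations of [Gamma_c(G, r^* A)].  The sums are over finite sets, and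
   their values are meaningful in the fibre at [grng g]. *)
Definition convol (f f' : garr G -> A) (g : garr G) : A :=
  \sum_(h \in [set h | grng h = grng g /\ f h != 0])
     cs_mul (f h) (ga_act h (f' (h \\ g))).

Definition convol_star (f : garr G -> A) (g : garr G) : A :=
  ga_act g (cs_star (f (ginv g))).

(* The regular representation of [f] on [l2(G_x) (x) A_x]. *)
Definition regular_rep (f xi : garr G -> A) (g : garr G) : A :=
  \sum_(h \in [set h | grng h = grng g /\ f h != 0])
     cs_mul (ga_act (ginv g) (f h)) (xi (h \\ g)).

Definition l2_ip (x : gobj G) (xi : garr G -> A) : A :=
  \sum_(g \in [set g | gsrc g = x]) cs_mul (cs_star (xi g)) (xi g).

Definition reduced_norm_le (f : garr G -> A) (M : R) :=
  forall (x : gobj G) (xi : garr G -> A), finite_set [set g | xi g <> 0] ->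
  forall d e : R, 0 < e -> fib_lt x (l2_ip x xi) d ->
    fib_lt x (l2_ip x (regular_rep f xi)) (M ^+ 2 * d + e).

(* [D] is the reduced crossed product of [A] by [G], [j] being the canonical
   map from [Gamma_c(G, r^* A)]. *)
Definition is_reduced_crossed_product (D : cstar) (j : (garr G -> A) -> D) :=
  [/\ forall k f f' u, compact_asection f -> compact_asection f' ->
        compact_asection u ->
        (forall g, fib_eq (grng g) (u g) (k *: f g + f' g)) ->
        j u = k *: j f + j f',
      forall f f' u, compact_asection f -> compact_asection f' ->
        compact_asection u ->
        (forall g, fib_eq (grng g) (u g) (convol f f' g)) ->
        j u = cs_mul (j f) (j f'),
      forall f u, compact_asection f -> compact_asection u ->
        (forall g, fib_eq (grng g) (u g) (convol_star f g)) ->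
        j u = cs_star (j f),
      forall f (M : R), compact_asection f -> 0 <= M ->
        (nrm (j f) <= M <-> reduced_norm_le f M) &
      forall (x : D) (e : R), 0 < e -> exists2 f, compact_asection f &
        nrm (x - j f) < e].

End CrossedProduct.

End GroupoidActions.

(* [K_i(D)] is [KK_i(C, D)], the case of the trivial groupoid and of the
   one-point space. *)
Definition plain_galg (D : cstar) : galg trivial_groupoid :=
  @GAlg trivial_groupoid D (fun phi a => (phi tt : C) *: a) (fun=> id).

Definition point_gspace : gspace trivial_groupoid :=
  @GSpace trivial_groupoid (discrete_topology unit) id (fun=> id).

Definition kcycle (D : cstar) := cycle (plain_galg D) point_gspace.

Definition is_kcycle (i : bool) (D : cstar) (c : kcycle D) :=
  is_cycle i setT c.

Definition k_homotopic (i : bool) (D : cstar) (c c' : kcycle D) :=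
  kk_homotopic i setT c c'.

Section Assembly.
Variable G : groupoid.

Local Notation "h \\ g" := (gmul (ginv h) g) (at level 40, left associativity).

Definition is_cutoff (P : gspace G) (Z : set P) (c : P -> R) :=
  [/\ {within Z, continuous c}, forall z, Z z -> 0 <= c z,
      (exists2 K, compact K & forall z, Z z -> ~ K z -> c z = 0) &
      forall z, Z z ->
        \sum_(g \in [set g : garr G | grng g = gs_anchor z])
           c (gs_act (ginv g) z) = 1].

(* [y] is the image of the cycle [x = (E, pi, F)]: the descent of [x] is a
   cycle whose module is the completion of [Gamma_c(G, r^* E)], and the product
   with the class of a projection [p] in [C_0(Z) x_r G] is its restriction
   along the homomorphism [C -> C_0(Z) x_r G] that maps 1 to [p].  Here
   [p (h)] is the function [z |-> (c (z) c (h^-1 z))^(1/2)] on the fibre of [Z]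
   at [grng h]. *)
Definition is_assembly (i : bool) (P : gspace G) (Z : set P) (A : galg G)
    (D : cstar) (j : (garr G -> A) -> D) (x : cycle A P) (y : kcycle D) :=
  let csec := compact_section (@efib_lt G A x) in
  exists (c : P -> R) (p : garr G -> P -> C^o) (q : (garr G -> x) -> y),
  [/\ is_cutoff Z c /\
      (forall h, C0 Z (p h) /\ forall z, Z z -> gs_anchor z = grng h ->
         p h z = (Num.sqrt (c z * c (gs_act (ginv h) z)))%:C),
      (* the module of [y] is the completion of [Gamma_c(G, r^* E)] *)
      [/\ forall k xi eta u, csec xi -> csec eta -> csec u ->
            (forall g, efib_eq (grng g) (u g) (k *: xi g + eta g)) ->
            q u = k *: q xi + q eta,
          forall xi eta f, csec xi -> csec eta -> compact_asection f ->
            (forall g, fib_eq (grng g) (f g)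
              (\sum_(h \in [set h | grng h = grng g /\ xi (ginv h) != 0])
                 ga_act h (hm_ip (xi (ginv h)) (eta (h \\ g))))) ->
            hm_ip (q xi) (q eta) = j f,
          forall xi f u, csec xi -> compact_asection f -> csec u ->
            (forall g, efib_eq (grng g) (u g)
              (\sum_(h \in [set h | grng h = grng g /\ xi h != 0])
                 hm_mul (xi h) (ga_act h (f (h \\ g))))) ->
            q u = hm_mul (q xi) (j f) &
          forall (v : y) (e : R), 0 < e -> exists2 xi, csec xi &
            nrm (v - q xi) < e],
      (* the complex number [w 1] acts as [w p] *)
      forall (w : point_gspace -> C^o) xi u, csec xi -> csec u ->
        (forall g, efib_eq (grng g) (u g)
          (\sum_(h \in [set h | grng h = grng g /\ xi (h \\ g) != 0])
             cy_rep (p h) (ge_act h (xi (h \\ g))))) ->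
        cy_rep w (q xi) = (w tt : C) *: q u,
      forall xi, csec xi -> cy_op (q xi) = q (fun g => cy_op (xi g)) &
      i = false -> forall xi, csec xi ->
        cy_grad (q xi) = q (fun g => cy_grad (xi g))].

(* [G] satisfies the Baum-Connes conjecture for [A]: the map induced on the
   inductive limit over the [G]-compact subsets [Z] of a universal proper
   [G]-space is bijective in both degrees. *)
Definition baum_connes (A : galg G) :=
  exists (P : gspace G) (D : cstar) (j : (garr G -> A) -> D),
  [/\ universal_proper P, is_reduced_crossed_product j &
      forall i : bool,
      (forall (Z1 Z2 : set P) (x1 x2 : cycle A P) (y1 y2 : kcycle D),
         gcompact Z1 -> gcompact Z2 -> is_cycle i Z1 x1 -> is_cycle i Z2 x2 ->
         is_kcycle i y1 -> is_kcycle i y2 ->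
         is_assembly i Z1 j x1 y1 -> is_assembly i Z2 j x2 y2 ->
         k_homotopic i y1 y2 ->
         exists Z : set P, [/\ gcompact Z, Z1 `<=` Z, Z2 `<=` Z &
           kk_homotopic i Z x1 x2]) /\
      (forall y : kcycle D, is_kcycle i y ->
         exists (Z : set P) (x : cycle A P) (y' : kcycle D),
         [/\ gcompact Z, is_cycle i Z x, is_kcycle i y',
             is_assembly i Z j x y' & k_homotopic i y' y])].

End Assembly.

Definition baum_connes_with_coefficients (G : groupoid) :=
  forall A : galg G, is_galg A -> baum_connes A.

(* [A] is the [G(X)]-C*-algebra of bounded functions from [X] to the compact
   operators on [l2(N)], with evaluations [ev]; [g] acts by [f |-> f o t^-1] for
   any partial bijection [t] of [X] at bounded distance such that [g] contains
   the set of the pairs [(t y, y)]. *)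
Definition is_ell_infty_K (X : metricType R) (A : galg (coarse_groupoid X))
    (ev : X -> A -> ell2 R nat -> ell2 R nat) :=
  [/\ forall a x, compact_op (ev x a),
      (forall k a b x xi, ev x (k *: a + b) xi = k *: ev x a xi + ev x b xi) /\
      (forall a b x, ev x (cs_mul a b) = ev x a \o ev x b) /\
      (forall a x, adjoint_ops (ev x a) (ev x (cs_star a))),
      (forall a (M : R), 0 <= M ->
         (nrm a <= M <-> forall x xi, l2norm (ev x a xi) <= M * l2norm xi)) /\
      (forall (f : X -> ell2 R nat -> ell2 R nat) (M : R),
         (forall x, compact_op (f x)) ->
         (forall x xi, l2norm (f x xi) <= M * l2norm xi) ->
         exists a, forall x, ev x a = f x),
      forall phi a x xi, C0 setT phi ->
        ev x (ga_mod phi a) xi = (phi (beta_pure x) : C) *: ev x a xi &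
      forall (g : garr (coarse_groupoid X)) (t : set (X * X)) (a b : A),
        beta_sets (\val (g : @coarse_arrows R X)) t ->
        (exists r, t `<=` Delta r) ->
        (forall x y x' y', t (x, y) -> t (x', y') -> x = x' <-> y = y') ->
        (forall x y, t (x, y) -> ev x b = ev y a) ->
        fib_eq (grng g) (ga_act g a) b].

Definition coarse_baum_connes_discrete (Y : metricType R) :=
  exists (A : galg (coarse_groupoid Y)) (ev : Y -> A -> ell2 R nat -> ell2 R nat),
    [/\ is_galg A, is_ell_infty_K ev & baum_connes A].

Definition coarse_baum_connes (X : metricType R) :=
  exists Y : metricType R,
  [/\ ulf Y, uniformly_discrete Y, bijectively_coarsely_equivalent X Y &
      coarse_baum_connes_discrete Y].

End CStar.

(* [X] is the countable discrete group [Gamma], identified with [X] by [phi],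
   with a proper left-invariant metric. *)
Definition is_group_with_proper_metric (R : realType) (Gamma : groupType)
    (X : metricType R) :=
  exists phi : Gamma -> X,
  [/\ countable [set: Gamma], bijective phi,
      forall g a b, mdist (phi (g * a)%g) (phi (g * b)%g) =
        mdist (phi a) (phi b) &
      forall (x : X) (r : R), finite_set [set y | mdist x y <= r]].

(* Main.v *)
(* The argument is in the spirit of Baudier, Braga, Farah, Khukhro, Vignati and
   Willett for uniform Roe algebras and of Martinez and Vigolo for Roe algebras.

   An isomorphism of two such algebras is implemented by a unitary U with
   inverse V.  By a Baire category argument, for an operator T in the algebra of
   X the images of all products of T with coordinate projections are
   approximated by operators of finite propagation at a uniform scale.  Apply
   this to V and choose signs for the coordinates of the image under U of a
   basis vector over x: the norm of the combination is 1, whereas on a ball around x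
   the signs can be chosen so that its square norm is at most the largest square
   mass on that ball of the images under V of basis vectors.  Hence some basis
   vector over a point f x of Y has an image under V of norm at least 1/4 near
   x.  Linking these vectors by sums of rank-one operators with separated supports,
   and using the uniform scale again, f and the analogous map from Y to X are
   coarse and mutually inverse up to bounded distance. *)

Require Import Defs.
From mathcomp Require Import all_boot all_order all_algebra.
From mathcomp Require Import complex finmap.
From mathcomp Require Import all_classical all_reals all_analysis.
From mathcomp Require Import summability ring lra.

Set Implicit Arguments.
Unset Strict Implicit.
Unset Printing Implicit Defensive.

Import Order.TTheory GRing.Theory Num.Theory numFieldNormedType.Exports.
Local Open Scope classical_set_scope.
Local Open Scope ring_scope.

Local Notation mask := Defs.mask.
#[local] Existing Instance totally_filter.
Arguments ell2_fun : simpl never.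

(** * Square-summable families *)

Lemma finite_set_ind (T : choiceType) (P : set T -> Prop) :
  P set0 ->
  (forall A x, finite_set A -> ~ A x -> P A -> P (x |` A)) ->
  forall A, finite_set A -> P A.
Proof.
move=> P0 PU A /finite_seqP[s ->] {A}.
elim: s => [|x s IH].
  by rewrite (_ : [set` [::]] = set0) //; apply/seteqP; split.
have -> : [set` x :: s] = x |` [set` s].
  by apply/seteqP; split=> y /=; rewrite inE;
    [case/orP=> [/eqP->|]; [left|right]|case=> [->|->]; rewrite ?eqxx ?orbT].
have [xs|xs] := pselect ([set` s] x).
  suff -> : x |` [set` s] = [set` s] by [].
  by apply/seteqP; split=> y //=; [case=> [->|]|right].
by apply: PU => //; exact: finite_seq.
Qed.

Section ScalarModulus.
Variable R : realType.
Local Notation C := R[i].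
Local Open Scope complex_scope.

(** The norm on [R[i]] takes values in [R[i]]; the estimates need a modulus with values in [R]. *)
Definition cmod (z : C) : R := Num.sqrt (sqmod z).

Lemma cmod_ge0 z : 0 <= cmod z. Proof. exact: sqrtr_ge0. Qed.

Lemma sqr_cmod z : cmod z ^+ 2 = sqmod z.
Proof. by rewrite sqr_sqrtr ?sqmod_ge0. Qed.

Lemma cmodM z w : cmod (z * w) = cmod z * cmod w.
Proof. by rewrite /cmod sqmodM sqrtrM ?sqmod_ge0. Qed.

Lemma normcE_cmod (z : C) : `|z| = (cmod z)%:C.
Proof. by rewrite normc_def. Qed.

Lemma cmodD z w : cmod (z + w) <= cmod z + cmod w.
Proof. by have := ler_normD z w; rewrite !normcE_cmod -rmorphD lecR. Qed.

Lemma cmod_real (x : R) : cmod x%:C = `|x|.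
Proof. by rewrite /cmod /sqmod /= expr0n addr0 sqrtr_sqr. Qed.

Lemma cmod_Complex_le (a b : R) : cmod (a +i* b) <= `|a| + `|b|.
Proof.
have -> : a +i* b = a%:C + 'i * b%:C.
  by apply/eqP; rewrite eq_complex /=; apply/andP; split; apply/eqP; ring.
apply: (le_trans (cmodD _ _)); rewrite cmodM !cmod_real.
rewrite (_ : cmod 'i = 1) ?mul1r //.
by rewrite /cmod /sqmod /= expr0n expr1n add0r sqrtr1.
Qed.

Lemma cmod0 : cmod 0 = 0. Proof. by rewrite (cmod_real 0) normr0. Qed.

Lemma sqmod0 : sqmod (0 : C) = 0.
Proof. by rewrite -sqr_cmod cmod0 expr0n. Qed.

Lemma sqmodN (z : C) : sqmod (- z) = sqmod z.
Proof. by case: z => a b; rewrite /sqmod /= !sqrrN. Qed.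

Lemma mulcJ (z : C) : z * z^* = (sqmod z)%:C.
Proof.
case: z => a b; apply/eqP; rewrite eq_complex /sqmod /=.
by apply/andP; split; apply/eqP; ring.
Qed.

Lemma sqmod_par (z w : C) :
  sqmod (z + w) + sqmod (z - w) = 2 * sqmod z + 2 * sqmod w.
Proof. by case: z w => a b [c d]; rewrite /sqmod /=; ring. Qed.

End ScalarModulus.

Section SquareNorm.
Variables (R : realType) (I : choiceType).
Local Notation C := R[i].
Local Notation L2 := (ell2 R I).
Local Open Scope complex_scope.
Implicit Types (u v w : L2) (A B F : set I).

Definition nsq v : R := fine (l2sum v).

Lemma l2sum_nsq v : l2sum v = (nsq v)%:E.
Proof.
rewrite /nsq fineK // ge0_fin_numE; first exact: (ell2_funP v).
by apply: esum_ge0 => i _; rewrite lee_fin sqmod_ge0.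
Qed.

Lemma nsq_ge0 v : 0 <= nsq v.
Proof.
by rewrite -lee_fin -l2sum_nsq esum_ge0 // => i _; rewrite lee_fin sqmod_ge0.
Qed.

Lemma l2norm_ge0 v : 0 <= l2norm v. Proof. exact: sqrtr_ge0. Qed.

Lemma sqr_l2norm v : l2norm v ^+ 2 = nsq v.
Proof. by rewrite sqr_sqrtr // nsq_ge0. Qed.

Lemma nsq_fsum_le v F : finite_set F -> \sum_(i \in F) sqmod (v i) <= nsq v.
Proof.
move=> finF; rewrite -lee_fin -l2sum_nsq -fsumEFin //.
by apply: esum_ge; exists F.
Qed.

Lemma nsq_le v (M : R) :
  (forall F, finite_set F -> \sum_(i \in F) sqmod (v i) <= M) -> nsq v <= M.
Proof.
move=> h; rewrite -lee_fin -l2sum_nsq.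
by apply: ge_ereal_sup => _ [F [finF _]] <-; rewrite fsumEFin // lee_fin h.
Qed.

Lemma nsq_coord v i : sqmod (v i) <= nsq v.
Proof.
by have := @nsq_fsum_le v [set i] (finite_set1 i); rewrite fsbig_set1.
Qed.

Lemma cmod_coord v i : cmod (v i) <= l2norm v.
Proof. by rewrite /cmod ler_sqrt ?nsq_ge0 // nsq_coord. Qed.

Lemma ell2_eqP u v : (forall i, u i = v i) -> u = v.
Proof. by move=> uv; apply: val_inj; apply/funext. Qed.

Lemma nsq_eq0 v : nsq v = 0 -> v = 0.
Proof.
move=> v0; apply: ell2_eqP => i.
have : sqmod (v i) <= 0 by rewrite -v0 nsq_coord.
move=> h; have : cmod (v i) ^+ 2 = 0.
  by rewrite sqr_cmod; apply/eqP; rewrite eq_le h sqmod_ge0.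
move=> /eqP; rewrite sqrf_eq0 => /eqP e.
by apply/eqP; rewrite -normr_eq0 normcE_cmod e.
Qed.

Lemma l2norm_eq0 v : l2norm v = 0 -> v = 0.
Proof. by move=> v0; apply: nsq_eq0; rewrite -sqr_l2norm v0 expr0n. Qed.

Lemma ell2DE u v i : (u + v) i = u i + v i. Proof. by []. Qed.
Lemma ell2NE u i : (- u) i = - u i. Proof. by []. Qed.
Lemma ell2ZE (k : C) u i : (k *: u) i = k * u i. Proof. by []. Qed.
Lemma ell20E i : (0 : L2) i = 0. Proof. by []. Qed.
Lemma maskE A u i : mask A u i = if i \in A then u i else 0. Proof. by []. Qed.

Lemma partial_sumE (V : zmodType) (x : I -> V) (A : {fset I}) :
  partial_sum x A = \sum_(i <- A) x i.
Proof. by rewrite big_seq_fsetE. Qed.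

Lemma totally_ge (F : {fset I}) : \forall A \near @totally I, (F `<=` A)%fset.
Proof. by exists F. Qed.

(** A supremum of finite sums of nonnegative terms is also their limit along finite sets ordered by
    inclusion. Limits, unlike suprema, are compatible with linear identities. *)
Lemma cvg_nsq v :
  partial_sum (fun i => sqmod (v i)) @ totally --> (nsq v : R^o).
Proof.
apply/cvgrPdist_le => e e0.
have : ((nsq v - e)%:E < l2sum v)%E by rewrite l2sum_nsq lte_fin; lra.
move=> /ereal_sup_gt[_ [F [finF _] <-]].
rewrite fsumEFin // lte_fin => hF.
near=> A.
have FA : (fset_set F `<=` A)%fset by near: A; exact: totally_ge.
have h1 : \sum_(i \in F) sqmod (v i) <= \sum_(i <- A) sqmod (v i).
  rewrite fsbig_finite //= (big_fsetID _ (fun i => i \in fset_set F) A) /=.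
  have -> : [fset x | x in A & x \in fset_set F]%fset = fset_set F.
    apply/fsetP => x; rewrite !inE /=; case: (boolP (x \in fset_set F)) => h.
      by rewrite (fsubsetP FA).
    by rewrite andbF.
  by rewrite lerDl sumr_ge0 // => i _; exact: sqmod_ge0.
have h2 : \sum_(i <- A) sqmod (v i) <= nsq v.
  have := @nsq_fsum_le v [set` A] (finite_fset A).
  by rewrite -fsbig_seq.
rewrite partial_sumE ger0_norm; lra.
Unshelve. all: by end_near. Qed.

(** Both sides are limits of the same net of finite sums. Scaling, the parallelogram law and
    Pythagoras for disjoint supports are instances, padded with zeros where fewer vectors occur. *)
Lemma nsq_lin (a b c d : R) u v u' v' :
  (forall i, a * sqmod (u i) + b * sqmod (v i) =
             c * sqmod (u' i) + d * sqmod (v' i)) ->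
  a * nsq u + b * nsq v = c * nsq u' + d * nsq v'.
Proof.
have key (a' b' : R) w w' : (fun A : {fset I} =>
    \sum_(i <- A) (a' * sqmod (w i) + b' * sqmod (w' i))) @ totally -->
    (a' * nsq w + b' * nsq w' : R^o).
  rewrite (_ : (fun A : {fset I} => _) = (fun A : {fset I} =>
      a' * partial_sum (fun i => sqmod (w i)) A +
      b' * partial_sum (fun i => sqmod (w' i)) A)); last first.
    by apply/funext => A; rewrite big_split /= -!mulr_sumr -!partial_sumE.
  by apply: (@cvgD _ R^o); apply: cvgM => //; do ?[exact: cvg_cst];
    exact: cvg_nsq.
move=> h; apply: (cvg_unique _ (key a b u v)) => //.
rewrite (_ : (fun A : {fset I} => _) = (fun A : {fset I} =>
  \sum_(i <- A) (c * sqmod (u' i) + d * sqmod (v' i)))); first exact: key.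
by apply/funext => A; apply: eq_bigr => i _; rewrite h.
Qed.

End SquareNorm.

Section Convergence.
Variable R : realType.
Local Notation C := R[i].
Local Open Scope complex_scope.

Lemma cvg_complex (T : Type) (F : set_system T) {FF : ProperFilter F}
    (f g : T -> R) (a b : R) :
  f @ F --> (a : R^o) -> g @ F --> (b : R^o) ->
  (fun x => f x +i* g x : C^o) @ F --> ((a +i* b) : C^o).
Proof.
move=> fa gb; apply/(@cvgrPdist_le C C^o T F _ _ _) => e e0.
(* A positive element of [R[i]] has imaginary part zero. *)
have /andP[/eqP /= ime ree] : (complex.Im e == 0) && (0 < complex.Re e).
  by move: e0; rewrite ltcE /= eq_sym => /andP[-> ->].
have re2 : 0 < complex.Re e / 2 by rewrite divr_gt0.
have ha := (@cvgrPdist_le R R^o T F _ f a).1 fa _ re2.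
have hb := (@cvgrPdist_le R R^o T F _ g b).1 gb _ re2.
near=> x.
rewrite normcE_cmod lecE /= ime eqxx /=.
have -> : (a +i* b) - (f x +i* g x) = (a - f x) +i* (b - g x) by [].
apply: (le_trans (cmod_Complex_le _ _)); rewrite [leRHS](splitr (complex.Re e)).
by apply: lerD; near: x; [exact: ha|exact: hb].
Unshelve. all: by end_near. Qed.

End Convergence.

(** * Polarization, Cauchy-Schwarz and truncation *)

Section InnerProduct.
Variables (R : realType) (I : choiceType).
Local Notation C := R[i].
Local Notation L2 := (ell2 R I).
Local Open Scope complex_scope.
Implicit Types (u v w : L2) (A B F : set I).

Lemma nsqZ (k : C) v : nsq (k *: v) = sqmod k * nsq v.
Proof.
have := @nsq_lin R I 1 0 (sqmod k) 0 (k *: v) 0 v 0.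
rewrite !mul0r !addr0 mul1r; apply => i.
by rewrite !mul0r !addr0 mul1r -sqmodM.
Qed.

Lemma nsqN v : nsq (- v) = nsq v.
Proof.
have := @nsq_lin R I 1 0 1 0 (- v) 0 v 0.
rewrite !mul0r !addr0 !mul1r; apply => i.
by rewrite !mul0r !addr0 !mul1r ell2NE sqmodN.
Qed.

Lemma nsq_par u v : nsq (u + v) + nsq (u - v) = 2 * nsq u + 2 * nsq v.
Proof.
have := @nsq_lin R I 1 1 2 2 (u + v) (u - v) u v.
by rewrite !mul1r; apply => i; rewrite !mul1r -sqmod_par.
Qed.

Lemma nsq_mask A v : nsq (mask A v) + nsq (mask (~` A) v) = nsq v.
Proof.
have := @nsq_lin R I 1 1 1 0 (mask A v) (mask (~` A) v) v 0.
rewrite !mul1r mul0r addr0; apply => i; rewrite !mul1r mul0r addr0 !maskE.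
by rewrite in_setC; case: ifP => _ /=; rewrite sqmod0 ?addr0 ?add0r.
Qed.

Lemma nsq_disjoint u v : (forall i, u i = 0 \/ v i = 0) ->
  nsq (u + v) = nsq u + nsq v.
Proof.
move=> h; have := @nsq_lin R I 1 0 1 1 (u + v) 0 u v.
rewrite !mul1r mul0r addr0; apply => i; rewrite !mul1r mul0r addr0 ell2DE.
by have [->|->] := h i; rewrite sqmod0 ?addr0 ?add0r.
Qed.

Lemma nsq_mono u v : (forall i, sqmod (u i) <= sqmod (v i)) -> nsq u <= nsq v.
Proof.
move=> uv; apply: nsq_le => F finF; apply: le_trans (nsq_fsum_le _ finF).
by rewrite -lee_fin -!fsumEFin //; apply: lee_fsum => // i _; rewrite lee_fin.
Qed.

Lemma l2norm_le (u : L2) (c : R) :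
  0 <= c -> (l2norm u <= c) = (nsq u <= c ^+ 2).
Proof. by move=> c0; rewrite -sqr_l2norm ler_sqr ?nnegrE // l2norm_ge0. Qed.

Lemma le_l2norm (J : choiceType) (u : L2) (v : ell2 R J) :
  (l2norm u <= l2norm v) = (nsq u <= nsq v).
Proof. by rewrite l2norm_le ?l2norm_ge0 // sqr_l2norm. Qed.

Lemma l2norm0 : l2norm (0 : L2) = 0.
Proof.
have := nsqZ 0 (0 : L2); rewrite scale0r sqmod0 mul0r => h.
by rewrite /l2norm -/(nsq _) h sqrtr0.
Qed.

Lemma l2normZ (k : C) v : l2norm (k *: v) = cmod k * l2norm v.
Proof. by rewrite /l2norm -!/(nsq _) nsqZ sqrtrM ?sqmod_ge0. Qed.

Lemma l2normN v : l2norm (- v) = l2norm v.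
Proof. by rewrite /l2norm -!/(nsq _) nsqN. Qed.

Lemma l2norm_mask A v : l2norm (mask A v) <= l2norm v.
Proof. by rewrite le_l2norm -[leRHS](nsq_mask A) lerDl nsq_ge0. Qed.

(* [polar] is written with [nsq] alone: the convergence of the partial sums of
   [l2dot] is inherited from [cvg_nsq], and a linear isometry preserves
   [l2dot]. *)
Definition polar u v : C :=
  ((nsq (u + v) - nsq (u - v)) / 4) +i*
  ((nsq (u + 'i *: v) - nsq (u - 'i *: v)) / 4).

Lemma cvg_dot_polar u v :
  partial_sum (fun i => u i * (v i)^* : C^o) @ totally --> (polar u v : C^o).
Proof.
have h w w' : (fun A : {fset I} => (partial_sum (fun i => sqmod (w i)) A -
    partial_sum (fun i => sqmod (w' i)) A) / 4) @ totally -->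
    ((nsq w - nsq w') / 4 : R^o).
  by apply: cvgM; [apply: (@cvgB _ R^o); exact: cvg_nsq | exact: cvg_cst].
rewrite (_ : partial_sum _ = (fun A : {fset I} =>
    ((partial_sum (fun i => sqmod ((u + v) i)) A -
      partial_sum (fun i => sqmod ((u - v) i)) A) / 4) +i*
    ((partial_sum (fun i => sqmod ((u + 'i *: v) i)) A -
      partial_sum (fun i => sqmod ((u - 'i *: v) i)) A) / 4) : C^o)).
  by apply: cvg_complex; exact: h.
apply/funext => A.
rewrite !partial_sumE -!sumrB !mulr_suml.
move: (A : seq I) => s; elim: s => [|i s IH]; first by rewrite !big_nil.
rewrite !big_cons IH /=.
set S := \sum_(j <- s) _; set T := \sum_(j <- s) _.
rewrite !ell2DE !ell2NE !ell2ZE.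
move: S T (u i) (v i) => S T [a b] [c d].
apply/eqP; rewrite eq_complex /sqmod /=.
by apply/andP; split; apply/eqP; field.
Qed.

Lemma l2dot_polar u v : l2dot u v = polar u v.
Proof.
rewrite /l2dot /summability.sum; apply: (@cvg_lim C^o).
  exact: norm_hausdorff.
exact: cvg_dot_polar.
Qed.

Lemma cvg_dot u v :
  partial_sum (fun i => u i * (v i)^* : C^o) @ totally --> (l2dot u v : C^o).
Proof. by rewrite l2dot_polar; exact: cvg_dot_polar. Qed.

Lemma l2dot_lin (k : C) u v w :
  l2dot (k *: u + v) w = k * l2dot u w + l2dot v w.
Proof.
have K : partial_sum (fun i => (k *: u + v) i * (w i)^* : C^o) @ totally -->
    (k * l2dot u w + l2dot v w : C^o).
  rewrite (_ : partial_sum _ = (fun A : {fset I} =>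
      (k : C^o) * partial_sum (fun i => u i * (w i)^* : C^o) A +
      partial_sum (fun i => v i * (w i)^* : C^o) A)).
    apply: (@cvgD _ C^o); last exact: cvg_dot.
    by apply: (@cvgM C); [exact: cvg_cst | exact: cvg_dot].
  apply/funext => A; rewrite !partial_sumE mulr_sumr -big_split /=.
  by apply: eq_bigr => i _; rewrite ell2DE ell2ZE mulrDl mulrA.
rewrite {1}/l2dot /summability.sum.
by apply: (@cvg_lim C^o); [exact: norm_hausdorff|exact: K].
Qed.

Lemma l2dotC u v : l2dot v u = (l2dot u v)^*%R.
Proof.
rewrite -[RHS]/(conjc _).
rewrite !l2dot_polar /polar /=.
have -> : v - u = - (u - v) by rewrite opprB.
have -> : v + 'i *: u = 'i *: (u - 'i *: v).
  by rewrite scalerBr scalerA -expr2 sqr_i scaleN1r opprK addrC.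
have -> : v - 'i *: u = (- 'i) *: (u + 'i *: v).
  rewrite scalerDr scalerA mulNr -expr2 sqr_i opprK scale1r scaleNr addrC //.
rewrite (addrC v u) nsqN !nsqZ sqmodN.
have -> : sqmod 'i = 1 :> R by rewrite /sqmod /= expr0n expr1n add0r.
by rewrite !mul1r -mulNr opprB.
Qed.

Lemma l2dot_self u : l2dot u u = (nsq u)%:C.
Proof.
have n0 : nsq (u - u) = 0 by rewrite subrr -sqr_l2norm l2norm0 expr0n.
rewrite l2dot_polar /polar n0.
have -> : u + u = (2%:R : C) *: u by rewrite scaler_nat mulr2n.
have -> : u + 'i *: u = (1 + 'i) *: u by rewrite scalerDl scale1r.
have -> : u - 'i *: u = (1 - 'i) *: u by rewrite scalerBl scale1r.
rewrite !nsqZ -mulrBl; apply/eqP; rewrite eq_complex /sqmod /=.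
by apply/andP; split; apply/eqP; field.
Qed.

Lemma l2dotDl u v w : l2dot (u + v) w = l2dot u w + l2dot v w.
Proof. by have := l2dot_lin 1 u v w; rewrite scale1r mul1r. Qed.

Lemma l2dot0l w : l2dot 0 w = 0.
Proof.
by apply: (@addrI _ (l2dot 0 w)); rewrite -l2dotDl !addr0.
Qed.

Lemma l2dot0r w : l2dot w 0 = 0.
Proof. by rewrite l2dotC l2dot0l rmorph0. Qed.

Lemma l2dotZl k u w : l2dot (k *: u) w = k * l2dot u w.
Proof. by have := l2dot_lin k u 0 w; rewrite addr0 l2dot0l addr0. Qed.

Lemma l2dotZr k u w : l2dot u (k *: w) = k^*%R * l2dot u w.
Proof. by rewrite l2dotC l2dotZl rmorphM /= -l2dotC. Qed.

Lemma l2dotBl u v w : l2dot (u - v) w = l2dot u w - l2dot v w.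
Proof. by rewrite l2dotDl -scaleN1r l2dotZl mulN1r. Qed.

Lemma l2dotBr u v w : l2dot w (u - v) = l2dot w u - l2dot w v.
Proof. by rewrite l2dotC l2dotBl rmorphB /= -!l2dotC. Qed.

Lemma l2dot_mask A u v : l2dot (mask A u) v = l2dot u (mask A v).
Proof.
rewrite /l2dot.
have -> // : (fun i => mask A u i * (v i)^* : C^o) =
             (fun i => u i * (mask A v i)^* : C^o).
apply/funext => i.
by rewrite !maskE; case: ifP => // _; rewrite mul0r rmorph0 mulr0.
Qed.

Lemma l2dot_CauchySchwarz u v : cmod (l2dot u v) <= l2norm u * l2norm v.
Proof.
rewrite -ler_sqr ?nnegrE ?mulr_ge0 ?cmod_ge0 ?l2norm_ge0 //.
rewrite exprMn !sqr_l2norm sqr_cmod.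
have [v0|v0] := eqVneq (nsq v) 0.
  by rewrite (nsq_eq0 v0) l2dot0r sqmod0 mulr_ge0 ?nsq_ge0.
have vp : 0 < nsq v by rewrite lt_neqAle eq_sym v0 nsq_ge0.
set d := l2dot u v.
(* This square norm expands to [nsq v * (nsq v * nsq u - sqmod d)], and [nsq v] is positive. *)
have : 0 <= (nsq ((nsq v)%:C *: u - d *: v))%:C by rewrite ler0c nsq_ge0.
rewrite -l2dot_self.
rewrite !l2dotBl !l2dotBr !l2dotZl !l2dotZr !l2dot_self (l2dotC u v) -/d.
rewrite -[((nsq v)%:C)^*%R]/(conjc _) conjc_real.
have -> : (nsq v)%:C * ((nsq v)%:C * (nsq u)%:C) - (nsq v)%:C * (d^* * d) -
  (d * ((nsq v)%:C * d^*) - d * (d^* * (nsq v)%:C)) =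
  ((nsq v) * (nsq v * nsq u - sqmod d))%:C.
  by rewrite !rmorphM rmorphB /= rmorphM /= -mulcJ; ring.
by rewrite ler0c pmulr_rge0 // subr_ge0 mulrC.
Qed.

Lemma l2normD u v : l2norm (u + v) <= l2norm u + l2norm v.
Proof.
rewrite l2norm_le ?addr_ge0 ?l2norm_ge0 // sqrrD !sqr_l2norm.
have h : nsq (u + v) = nsq u + nsq v + 2 * complex.Re (l2dot u v).
  apply: (@complexI R); rewrite -l2dot_self l2dotDl.
  rewrite (l2dotC (u + v) u) (l2dotC (u + v) v) !l2dotDl .
  rewrite !rmorphD /= -!l2dotC !l2dot_self (l2dotC u v) -[_^*%R]/(conjc _).
  case: (l2dot u v) => a b; apply/eqP; rewrite eq_complex /=.
  by apply/andP; split; apply/eqP; ring.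
have : complex.Re (l2dot u v) <= l2norm u * l2norm v.
  apply: le_trans (l2dot_CauchySchwarz u v); rewrite /cmod /sqmod.
  apply: (le_trans (ler_norm _)); rewrite -sqrtr_sqr ler_wsqrtr //.
  by rewrite lerDl sqr_ge0.
rewrite h; lra.
Qed.

Lemma l2normB u v : l2norm (u - v) <= l2norm u + l2norm v.
Proof. by rewrite -(l2normN v) l2normD. Qed.

(** Some finite partial sum comes within [e ^+ 2] of the supremum; by Pythagoras the complement
    carries at most that much. *)
Lemma l2norm_trunc v (e : R) : 0 < e ->
  exists2 F, finite_set F & l2norm (mask (~` F) v) <= e.
Proof.
move=> e0.
have : ((nsq v - e ^+ 2)%:E < l2sum v)%E.
  by rewrite l2sum_nsq lte_fin ltrBlDr ltrDl exprn_gt0.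
move=> /ereal_sup_gt[_ [F [finF _] <-]]; rewrite fsumEFin // lte_fin => h.
exists F => //; rewrite l2norm_le ?(ltW e0) //.
have : \sum_(i \in F) sqmod (v i) <= nsq (mask F v).
  rewrite (_ : \sum_(i \in F) sqmod (v i) = \sum_(i \in F) sqmod (mask F v i)).
    exact: nsq_fsum_le.
  by apply: eq_fsbigr => i iF; rewrite maskE iF.
have := nsq_mask F v; lra.
Qed.

End InnerProduct.

(** * Operators on square-summable families *)

Section LinearMaps.
Variables (K : nzRingType) (V W : lmodType K) (f : V -> W).
Hypothesis f_lin : linear f.

Lemma linD u v : f (u + v) = f u + f v.
Proof. by have := f_lin 1 u v; rewrite !scale1r. Qed.

Lemma lin0 : f 0 = 0.
Proof. by apply: (@addrI _ (f 0)); rewrite -linD !addr0. Qed.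

Lemma linZ k u : f (k *: u) = k *: f u.
Proof. by have := f_lin k u 0; rewrite !addr0 lin0 addr0. Qed.

Lemma linN u : f (- u) = - f u.
Proof. by rewrite -scaleN1r linZ scaleN1r. Qed.

Lemma linB u v : f (u - v) = f u - f v.
Proof. by rewrite linD linN. Qed.

End LinearMaps.

Lemma in_classical_set1 (T : choiceType) (i j : T) :
  (j \in ([set i] : set T)) = (j == i).
Proof. by apply/idP/eqP => [/set_mem //|->]; apply: mem_set. Qed.

Section Operators.
Variables (R : realType) (I : choiceType).
Local Notation C := R[i].
Local Notation L2 := (ell2 R I).
Local Open Scope complex_scope.
Implicit Types (u v w : L2) (A B F M : set I) (a b : L2 -> L2).

Lemma delta_subproof (i : I) :
  (fun j => if j == i then 1 else 0 : C) \in ell2_pred (R := R) (I := I).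
Proof.
rewrite /in_mem /= /ell2_pred /l2sum.
rewrite (_ : (\esum_(j in _) _)%E = (\esum_(j in [set i]) 1%:E)%E).
  by rewrite esum_set1 ?ltry // lee_fin.
rewrite [RHS]esum_mkcond; apply: eq_esum => j _; rewrite in_classical_set1.
by case: eqP => _; rewrite /sqmod /= ?expr0n ?expr1n /= addr0.
Qed.

Definition delta (i : I) : L2 := Ell2 (delta_subproof i).

Lemma deltaE i j : delta i j = if j == i then 1 else 0. Proof. by []. Qed.

Lemma maskE_in A u i : A i -> mask A u i = u i.
Proof. by move=> Ai; rewrite maskE mem_set. Qed.

Lemma maskE_out A u i : ~ A i -> mask A u i = 0.
Proof. by move=> Ai; rewrite maskE memNset. Qed.

Lemma mask_linear A : linear (mask A : L2 -> L2).
Proof.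
move=> k u v; apply: ell2_eqP => i; rewrite ell2DE ell2ZE !maskE ell2DE ell2ZE.
by case: ifP => // _; rewrite mulr0 addr0.
Qed.

Lemma mask_mask A B u : mask A (mask B u) = mask (A `&` B) u.
Proof.
by apply: ell2_eqP => i; rewrite !maskE in_setI; do 2?case: (i \in _).
Qed.

Lemma l2norm_mask_sub A B u :
  A `<=` B -> l2norm (mask A u) <= l2norm (mask B u).
Proof. by move=> AB; rewrite -(setIidl AB) -mask_mask l2norm_mask. Qed.

Lemma l2dot_mask_self A u : l2dot (mask A u) u = (nsq (mask A u))%:C.
Proof. by rewrite -l2dot_self -l2dot_mask mask_mask setIid. Qed.

Lemma mask_setC A u : mask A u + mask (~` A) u = u.
Proof.
apply: ell2_eqP => i; rewrite ell2DE !maskE in_setC.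
by case: (i \in A); rewrite ?addr0 ?add0r.
Qed.

Lemma mask_id A u : (forall i, ~ A i -> u i = 0) -> mask A u = u.
Proof.
move=> h; apply: ell2_eqP => i; rewrite maskE.
by case: (boolP (i \in A)) => // /negP iA; rewrite h // => /mem_set.
Qed.

Lemma mask_eq0 A u : (forall i, A i -> u i = 0) -> mask A u = 0.
Proof.
move=> h; apply: ell2_eqP => i; rewrite maskE.
by case: (boolP (i \in A)) => // /set_mem /h.
Qed.

Lemma mask_set1 i u : mask [set i] u = u i *: delta i.
Proof.
apply: ell2_eqP => j; rewrite ell2ZE deltaE maskE in_classical_set1.
by case: eqP => [->|]; rewrite ?mulr1 ?mulr0.
Qed.

Lemma mask_setU1 i A u : ~ A i -> mask (i |` A) u = u i *: delta i + mask A u.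
Proof.
move=> Ai; rewrite -mask_set1; apply: ell2_eqP => j; rewrite ell2DE !maskE.
rewrite in_setU in_classical_set1.
case: eqP => [->|_] /=; last by rewrite add0r.
by rewrite memNset // addr0.
Qed.

Lemma nsq_delta i : nsq (delta i) = 1.
Proof.
have sqd : sqmod (delta i i) = 1.
  by rewrite deltaE eqxx /sqmod /= expr0n expr1n addr0.
apply/eqP; rewrite eq_le -{2}sqd nsq_coord andbT.
apply: nsq_le => F finF; have [Fi|Fi] := pselect (F i).
  rewrite (fsbigD1 i) //= sqd fsbig1 ?addr0 // => j [_ /= /eqP ji].
  by rewrite deltaE (negbTE ji) sqmod0.
rewrite fsbig1 // => j Fj; rewrite deltaE; case: eqP => [ji|_].
  by rewrite ji in Fj.
by rewrite sqmod0.
Qed.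

Lemma l2norm_delta i : l2norm (delta i) = 1.
Proof. by rewrite /l2norm -/(nsq _) nsq_delta sqrtr1. Qed.

Lemma l2dot_delta u i : l2dot u (delta i) = u i.
Proof.
have h : mask [set i] (delta i) = delta i.
  by apply: mask_id => j ji; rewrite deltaE; case: eqP.
by rewrite -h -l2dot_mask mask_set1 l2dotZl l2dot_self nsq_delta mulr1.
Qed.

Lemma bounded_opP a : bounded_op a ->
  exists2 M : R, 0 < M & forall u, l2norm (a u) <= M * l2norm u.
Proof.
move=> [_ [M hM]]; exists (`|M| + 1) => [|u].
  by rewrite ltr_wpDl.
apply: (le_trans (hM u)); apply: ler_wpM2r; first exact: l2norm_ge0.
by rewrite (le_trans (ler_norm _)) // lerDl.
Qed.

Lemma bounded_op_linear a : bounded_op a -> linear a. Proof. by case. Qed.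

Lemma bounded_op_mask A : bounded_op (mask (R := R) A).
Proof.
by split; [exact: mask_linear|exists 1 => u; rewrite mul1r l2norm_mask].
Qed.

Lemma bounded_op_comp a b : bounded_op a -> bounded_op b -> bounded_op (a \o b).
Proof.
move=> ba bb; have [M M0 hM] := bounded_opP ba.
have [N N0 hN] := bounded_opP bb.
split=> [k u v|]; first by rewrite /= bb.1 ba.1.
exists (M * N) => u; rewrite /= -mulrA (le_trans (hM _)) //.
by rewrite ler_wpM2l // ltW.
Qed.

Lemma cmod_eq0 (z : C) : (forall e : R, 0 < e -> cmod z <= e) -> z = 0.
Proof.
move=> h; apply/eqP; rewrite -normr_eq0 normcE_cmod.
suff -> : cmod z = 0 by [].
apply/eqP; rewrite eq_le cmod_ge0 andbT; apply/ler_addgt0Pr => e /h.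
by rewrite add0r.
Qed.

(** Linearity settles finite truncations of [u], and boundedness of [a] makes the contribution of
    the remaining tail arbitrarily small. *)
Lemma op_coord_eq0 a u j : bounded_op a ->
  (forall i, u i != 0 -> a (delta i) j = 0) -> a u j = 0.
Proof.
move=> ba h; have al := ba.1; have [M M0 hM] := bounded_opP ba.
have hF F : finite_set F -> a (mask F u) j = 0.
  elim/finite_set_ind => [|A x _ Ax IH].
    by rewrite mask_eq0 // (lin0 al).
  rewrite mask_setU1 // (linD al) (linZ al) ell2DE IH addr0 ell2ZE.
  by have [->|/h ->] := eqVneq (u x) 0; rewrite ?mul0r ?mulr0.
apply: cmod_eq0 => e e0.
have [|F finF le_e] := @l2norm_trunc _ _ u (e / M); first exact: divr_gt0.
rewrite -{1}(mask_setC F u) (linD al) ell2DE hF // add0r.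
rewrite (le_trans (cmod_coord _ _)) // (le_trans (hM _)) //.
by rewrite -ler_pdivlMl // mulrC.
Qed.

Definition rank_one u v : L2 -> L2 := fun w => l2dot w v *: u.

Lemma rank_one_linear u v : linear (rank_one u v).
Proof. by move=> k w w'; rewrite /rank_one l2dot_lin scalerDl scalerA. Qed.

Lemma l2norm_rank_one u v w :
  l2norm (rank_one u v w) <= l2norm u * l2norm v * l2norm w.
Proof.
rewrite /rank_one l2normZ mulrC -mulrA ler_wpM2l ?l2norm_ge0 //.
by rewrite mulrC l2dot_CauchySchwarz.
Qed.

Lemma bounded_op_rank_one u v : bounded_op (rank_one u v).
Proof.
by split; [exact: rank_one_linear|eexists=> w; exact: l2norm_rank_one].
Qed.

Lemma interval_net (m d : R) : 0 < d -> exists s : seq R,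
  forall x, `|x| <= m -> exists2 y, y \in s & `|x - y| <= d.
Proof.
move=> d0; pose N := (Num.truncn (2 * m / d)).+1.
exists [seq (- m + k%:R * d) | k <- iota 0 N] => x; rewrite ler_norml.
move=> /andP[mx xm]; pose k := Num.truncn ((x + m) / d).
have q0 : 0 <= (x + m) / d by apply: divr_ge0; [lra|exact: ltW].
have /andP[k1 k2] : k%:R <= (x + m) / d < k.+1%:R by exact: truncn_itv.
exists (- m + k%:R * d).
  apply/mapP; exists k => //; rewrite mem_iota add0n ltnS leq0n /=.
  by apply: le_truncn; rewrite ler_pM2r ?invr_gt0 //; lra.
rewrite ler_pdivlMr // in k1; rewrite ltr_pdivrMr // -natr1 mulrDl mul1r in k2.
by rewrite ger0_norm; lra.
Qed.

Lemma disc_net (m d : R) : 0 < d -> exists s : seq C,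
  forall z, cmod z <= m -> exists2 c, c \in s & cmod (z - c) <= d.
Proof.
move=> d0; have [|s hs] := @interval_net m (d / 2); first exact: divr_gt0.
exists [seq x +i* y | x <- s, y <- s] => -[x y] zm.
have [xm ym] : `|x| <= m /\ `|y| <= m.
  split; apply: le_trans zm; rewrite -sqrtr_sqr /cmod /sqmod /= ler_wsqrtr //.
    by rewrite lerDl sqr_ge0.
  by rewrite lerDr sqr_ge0.
have [x' x's hx] := hs x xm; have [y' y's hy] := hs y ym.
exists (x' +i* y'); first by apply/allpairsP; exists (x', y').
have -> : (x +i* y) - (x' +i* y') = (x - x') +i* (y - y') by [].
by rewrite (le_trans (cmod_Complex_le _ _)) // [leRHS](splitr d) lerD.
Qed.

(** The unit ball is mapped to multiples of [u] with coefficients in the disc of radius [l2norm v],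
    so a finite net of that disc suffices. The 1 added to [l2norm u] keeps the divisor positive when
    [u] is zero. *)
Lemma compact_rank_one u v : compact_op (rank_one u v).
Proof.
split; first exact: bounded_op_rank_one.
move=> e e0; have u1 : 0 < l2norm u + 1 by rewrite ltr_wpDl ?l2norm_ge0.
have [|s hs] := @disc_net (l2norm v) (e / (l2norm u + 1)).
  exact: divr_gt0.
exists [seq c *: u | c <- s] => w w1.
have [|c cs hc] := hs (l2dot w v).
  rewrite (le_trans (l2dot_CauchySchwarz _ _)) // -[leRHS]mul1r ler_wpM2r //.
  exact: l2norm_ge0.
exists (c *: u); first by apply/mapP; exists c.
rewrite /rank_one -scalerBl l2normZ; move: hc; rewrite ler_pdivlMr // => hc.
apply: le_trans hc; apply: ler_wpM2l; first exact: cmod_ge0.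
by rewrite lerDl.
Qed.

Lemma compact_mask M a : compact_op a -> compact_op (mask M \o a).
Proof.
move=> [ba ha]; split; first exact: bounded_op_comp (bounded_op_mask M) ba.
move=> e /ha[s hs]; exists [seq mask M v | v <- s] => u /hs[v vs huv].
exists (mask M v); first by apply/mapP; exists v.
by rewrite /= -(linB (mask_linear M)) (le_trans (l2norm_mask _ _)).
Qed.

End Operators.

(** * Roe algebras of fibred index sets *)

Section FibredAlgebra.
Variables (R : realType) (X : metricType R) (I : choiceType) (p : I -> X).
Local Notation C := R[i].
Local Notation L2 := (ell2 R I).
Local Open Scope complex_scope.
Implicit Types (u v w : L2) (A B F M : set I) (a b T : L2 -> L2).

(* The Roe algebra of [X] is the case [p = fst : X * nat -> X]; the uniform Roe
   algebra is the case [p = id], whose entries automatically have rank one. *)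
Definition locally_compact_ops : set (L2 -> L2) :=
  [set a | [/\ bounded_op a, finite_propagation p a &
    forall x y, compact_op (op_entry p a x y)]].

Definition fibred_roe_algebra : set (L2 -> L2) :=
  op_closure locally_compact_ops.

Lemma fibred_roe_bounded a : fibred_roe_algebra a -> bounded_op a.
Proof. by case. Qed.

Lemma op_closure_sub (S : set (L2 -> L2)) :
  (forall a, S a -> bounded_op a) -> S `<=` op_closure S.
Proof.
move=> bS a Sa; split; first exact: bS.
move=> e e0; exists a => // u; rewrite subrr l2norm0 mulr_ge0 ?l2norm_ge0 //.
exact: ltW.
Qed.

Lemma locally_compact_sub : locally_compact_ops `<=` fibred_roe_algebra.
Proof. by apply: op_closure_sub => a []. Qed.

Lemma op_entry_rank_one u v x y : op_entry p (rank_one u v) x y =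
  rank_one (mask (p @^-1` [set y]) u) (mask (p @^-1` [set x]) v).
Proof.
apply/funext => w; rewrite /op_entry /rank_one /=.
by rewrite (linZ (mask_linear _)) l2dot_mask.
Qed.

Lemma finite_bound (T : choiceType) (F : set T) (f : T -> R) : finite_set F ->
  exists m : R, forall t, F t -> f t <= m.
Proof.
elim/finite_set_ind => [|A t _ _ [m hm]]; first by exists 0.
exists (Num.max m (f t)) => t' [->|/hm h]; first by rewrite le_max lexx orbT.
by rewrite le_max h.
Qed.

Lemma rank_one_fin_supp u v F F' : finite_set F -> finite_set F' ->
  locally_compact_ops (rank_one (mask F u) (mask F' v)).
Proof.
move=> finF finF'; split; first exact: bounded_op_rank_one.
  have [m hm] := @finite_bound _ (F' `*` F) (fun t => mdist (p t.1) (p t.2))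
    (finite_setX finF' finF).
  exists m => x y; rewrite op_entry_rank_one => ne.
  have [[i [Fi pi]]|nF] := pselect (exists i, F i /\ p i = y); last first.
    case: ne; apply/funext => w.
    rewrite /rank_one (@mask_eq0 _ _ _ (mask F u)) ?scaler0 // => i pi.
    by rewrite maskE_out // => Fi; apply: nF; exists i.
  have [[j [Fj pj]]|nF] := pselect (exists j, F' j /\ p j = x); last first.
    case: ne; apply/funext => w.
    rewrite /rank_one (@mask_eq0 _ _ _ (mask F' v)) ?l2dot0r ?scale0r //.
    by move=> k pk; rewrite maskE_out // => Fk; apply: nF; exists k.
  by rewrite -pi -pj; apply: (hm (j, i)).
by move=> x y; rewrite op_entry_rank_one; exact: compact_rank_one.
Qed.

(** Truncate [u] and [v] to finite sets. The error is a sum of two rank-one operators, each having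
    one small tail as a factor. *)
Lemma fibred_roe_rank_one u v : fibred_roe_algebra (rank_one u v).
Proof.
split; first exact: bounded_op_rank_one.
move=> e e0; have v1 : 0 < l2norm v + 1 by rewrite ltr_wpDl ?l2norm_ge0.
have u1 : 0 < l2norm u + 1 by rewrite ltr_wpDl ?l2norm_ge0.
have [|F finF hF] := @l2norm_trunc _ _ u (e / 2 / (l2norm v + 1)).
  by rewrite !divr_gt0.
have [|F' finF' hF'] := @l2norm_trunc _ _ v (e / 2 / (l2norm u + 1)).
  by rewrite !divr_gt0.
exists (rank_one (mask F u) (mask F' v)); first exact: rank_one_fin_supp.
move=> w.
have -> : rank_one u v w - rank_one (mask F u) (mask F' v) w =
    rank_one (mask (~` F) u) v w + rank_one (mask F u) (mask (~` F') v) w.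
  rewrite /rank_one -{1}(mask_setC F u) scalerDr.
  have -> : l2dot w v = l2dot w (mask F' v) + l2dot w (mask (~` F') v).
    by rewrite -{1}(mask_setC F' v) (l2dotC _ w) l2dotDl rmorphD /= -!l2dotC.
  by rewrite addrAC -scalerBl addrAC subrr add0r addrC.
rewrite (le_trans (l2normD _ _)) // [e]splitr mulrDl.
apply: lerD; apply: (le_trans (l2norm_rank_one _ _ _));
  rewrite ler_wpM2r ?l2norm_ge0 //.
  rewrite ler_pdivlMr // in hF; apply: le_trans hF.
  by rewrite ler_wpM2l ?l2norm_ge0 // lerDl.
rewrite ler_pdivlMr // in hF'; apply: le_trans hF'.
rewrite mulrC ler_wpM2l ?l2norm_ge0 // (le_trans (l2norm_mask _ _)) //.
by rewrite lerDl.
Qed.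

(** Coordinate projections act as multipliers: they commute with taking entries. They need not lie
    in the algebra themselves, since a projection onto an infinite part of a fibre is not locally
    compact. *)
Lemma locally_compact_mask M a :
  locally_compact_ops a -> locally_compact_ops (mask M \o a).
Proof.
have eE b x y : op_entry p (mask M \o b) x y = mask M \o op_entry p b x y.
  apply/funext => w; rewrite /op_entry /= !mask_mask setIC //.
move=> [ba [r hr] ca]; split.
- by apply: bounded_op_comp => //; exact: bounded_op_mask.
- exists r => x y ne; apply: hr => e; apply: ne; rewrite eE e.
  by apply/funext => w /=; rewrite (lin0 (mask_linear _)).
- by move=> x y; rewrite eE; apply: compact_mask.
Qed.

Lemma fibred_roe_mask M a :
  fibred_roe_algebra a -> fibred_roe_algebra (mask M \o a).
Proof.
move=> [ba ha]; split.
  by apply: bounded_op_comp => //; exact: bounded_op_mask.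
move=> e /ha[b hb hab]; exists (mask M \o b); first exact: locally_compact_mask.
move=> u; rewrite /= -(linB (mask_linear M)).
exact: le_trans (l2norm_mask _ _) (hab u).
Qed.

(** Here [M] meets each fibre at most once, so the propagation is zero and each entry is zero or a
    rank-one projection. With infinite fibres such projections stand in for the identity. *)
Lemma transversal_mask M : (forall i j, M i -> M j -> p i = p j -> i = j) ->
  fibred_roe_algebra (mask M).
Proof.
move=> hM; apply: locally_compact_sub.
have eE x y : op_entry p (mask M) x y =
    mask (p @^-1` [set y] `&` (M `&` p @^-1` [set x])).
  by apply/funext => w; rewrite /op_entry /= !mask_mask setIA.
split; first exact: bounded_op_mask.
  exists 0 => x y; rewrite eE => ne; have [->|xy] := eqVneq x y.
    by rewrite mdistxx.
  case: ne; apply/funext => w; apply: mask_eq0 => i [/= iy [_ /= ix]].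
  by move: xy; rewrite -ix -iy eqxx.
move=> x y; rewrite eE; set S := _ `&` _.
have [[i Si]|nS] := pselect (exists i, S i); last first.
  rewrite (_ : mask S = rank_one 0 0); first exact: compact_rank_one.
  apply/funext => w; rewrite /rank_one scaler0 mask_eq0 // => i Si.
  by case: nS; exists i.
rewrite (_ : mask S = rank_one (delta R i) (delta R i)).
  exact: compact_rank_one.
apply/funext => w; rewrite /rank_one l2dot_delta -mask_set1.
congr (mask _ w); apply/seteqP; split=> [j|j ->//] /=.
by case: Si => [iy [Mi ix]] [jy [Mj jx]]; apply: hM => //; rewrite jx ix.
Qed.

(** This passes from entries to vectors: a coordinate of the image is determined by the coordinates
    of [u] within the propagation. *)
Lemma finite_propagation_coord a : bounded_op a -> finite_propagation p a ->
  exists r : R, forall u j, (forall i, u i != 0 -> r < mdist (p i) (p j)) ->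
    a u j = 0.
Proof.
move=> ba [r hr]; exists r => u j hu; apply: op_coord_eq0 => // i /hu rij.
have : op_entry p a (p i) (p j) = (fun=> 0).
  apply: contrapT => /hr; by rewrite leNgt rij.
move=> /(congr1 (fun f : L2 -> L2 => f (delta R i) j)); rewrite /op_entry /=.
rewrite maskE_in // (_ : mask _ (delta R i) = delta R i) //.
by apply: mask_id => k /= ki; rewrite deltaE; case: eqP ki => // ->.
Qed.

(** A weak form of being close to an operator of finite propagation. Only vectors supported in a
    ball of fixed radius [rho] are tested, and each test is a non-strict inequality, hence a closed
    condition, as the Baire argument requires. *)
Definition tail_bound (rho e r : R) T := forall (y : X) u,
  (forall i, rho < mdist y (p i) -> u i = 0) ->
  l2norm (mask [set i | r < mdist y (p i)] (T u)) <= e * l2norm u.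

Lemma fibred_roe_tail a (rho e : R) : fibred_roe_algebra a -> 0 < e ->
  exists r, tail_bound rho e r a.
Proof.
move=> Aa e0; have [b [bb fb _] hb] := Aa.2 _ e0.
have [r hr] := finite_propagation_coord bb fb.
exists (rho + r) => y u hu.
have h0 : mask [set i | rho + r < mdist y (p i)] (b u) = 0.
  apply: mask_eq0 => j /= yj; apply: hr => i ui.
  have : mdist y (p i) <= rho.
    by rewrite leNgt; apply/negP => /hu ui0; rewrite ui0 eqxx in ui.
  have := metric_triangle y (p i) (p j); lra.
rewrite -[a u](subrK (b u)) (linD (mask_linear _)) h0 addr0.
exact: le_trans (l2norm_mask _ _) (hb u).
Qed.

(** Up to a small error, the image in the fibre at [x] depends on the finitely many fibres within
    the propagation of an approximant [b]; the corresponding entries of [b] are compact, hence small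
    off a finite set of indices. *)
Lemma fibred_roe_fiber_compact a x (e : R) : fibred_roe_algebra a -> 0 < e ->
  (forall r : R, finite_set [set y | mdist x y <= r]) ->
  exists2 F : set I, finite_set F &
    forall u i, p i = x -> ~ F i -> cmod (a u i) <= e * l2norm u.
Proof.
move=> Aa e0 finX; have e2 : 0 < e / 2 by rewrite divr_gt0.
have [b [bb fb cb] hb] := Aa.2 _ e2.
have [r hr] := finite_propagation_coord bb fb; have bl := bb.1.
suff [F finF hF] : exists2 F : set I, finite_set F & forall u i, p i = x ->
    ~ F i -> cmod (b (mask (p @^-1` [set y | mdist x y <= r]) u) i) <=
      e / 2 * l2norm u.
  exists F => // u i pi Fi; rewrite -[a u](subrK (b u)) ell2DE.
  rewrite (le_trans (cmodD _ _)) // [in leRHS](splitr e) mulrDl lerD //.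
    exact: le_trans (cmod_coord _ _) (hb u).
  suff -> : b u i = b (mask (p @^-1` [set y | mdist x y <= r]) u) i.
    exact: hF.
  rewrite -{1}(mask_setC (p @^-1` [set y | mdist x y <= r]) u) (linD bl) ell2DE.
  rewrite [X in _ + X]hr ?addr0 // => j; rewrite maskE.
  case: ifP => [|_]; last by rewrite eqxx.
  by move=> /set_mem /= /negP; rewrite -ltNge pi metric_sym.
have := finX r; move: [set y | _] => B finB.
(* Induction over the fibres within reach, for every error [d]: half of it goes to the new fibre and
   half to the others. *)
elim/finite_set_ind: finB (e / 2) e2 => [|A y _ Ay IH] d d0.
  exists set0 => // u i _ _; rewrite mask_eq0 // (lin0 bl) ell20E cmod0.
  by rewrite mulr_ge0 ?l2norm_ge0 // ltW.
have d2 : 0 < d / 2 by rewrite divr_gt0.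
have [F finF hF] := IH _ d2.
(* [s] is a finite [d / 4]-net of the image of the unit ball under the compact entry from [y] to
   [x]; off a finite set [F'] all its members are [d / 4]-small. *)
have [_ /(_ (d / 4))[|s hs]] := cb y x; first by rewrite divr_gt0.
have [F' finF' hF'] : exists2 F' : set I, finite_set F' &
    forall v, v \in s -> l2norm (mask (~` F') v) <= d / 4.
  elim: s {hs} => [|v s [F1 fin1 h1]]; first by exists set0.
  have [|F2 fin2 h2] := @l2norm_trunc _ _ v (d / 4); first by rewrite divr_gt0.
  exists (F1 `|` F2); first by rewrite finite_setU.
  move=> w; rewrite inE => /orP[/eqP->|/h1 h].
    by apply: le_trans h2; apply/l2norm_mask_sub/subsetC/subsetUr.
  by apply: le_trans h; apply/l2norm_mask_sub/subsetC/subsetUl.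
exists (F `|` F'); first by rewrite finite_setU.
move=> u i pi /not_orP[Fi F'i].
have -> : mask (p @^-1` (y |` A)) u =
    mask (p @^-1` [set y]) u + mask (p @^-1` A) u.
  apply: ell2_eqP => j; rewrite ell2DE !maskE preimage_setU in_setU.
  have [jy|jy] := boolP (j \in p @^-1` [set y]); last by rewrite add0r.
  rewrite memNset ?addr0 //= => Aj; apply: Ay; move: jy => /set_mem /= <-.
  exact: Aj.
rewrite (linD bl) ell2DE (le_trans (cmodD _ _)) // [in leRHS](splitr d) mulrDl.
apply: lerD; last exact: hF.
(* The net concerns the unit ball, so [u] is normalized and the zero vector treated apart. *)
have [u0|u0] := eqVneq (l2norm u) 0.
  rewrite (l2norm_eq0 u0) (lin0 (mask_linear _)) (lin0 bl) ell20E cmod0.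
  by rewrite l2norm0 mulr0.
have up : 0 < l2norm u by rewrite lt_neqAle eq_sym u0 l2norm_ge0.
have [|v vs hv] := hs (((l2norm u)^-1)%:C *: u).
  by rewrite l2normZ cmod_real gtr0_norm ?invr_gt0 // mulVf.
have hF'i : cmod (v i) <= d / 4.
  apply: le_trans (hF' v vs).
  by rewrite -(@maskE_in _ _ (~` F') v i F'i) cmod_coord.
move: hv; rewrite (linZ (bounded_op_linear (cb y x).1)) => hv.
have := le_trans (cmod_coord _ i) hv; rewrite ell2DE ell2NE ell2ZE => hc.
have : cmod (((l2norm u)^-1)%:C * op_entry p b y x u i) <= d / 2.
  rewrite -[X in cmod X](subrK (v i)) (le_trans (cmodD _ _)) //.
  by rewrite (splitr (d / 2)) lerD // -mulrA -invfM -natrM.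
rewrite cmodM cmod_real gtr0_norm ?invr_gt0 // mulrC ler_pdivrMr //.
by rewrite /op_entry /= maskE_in.
Qed.

End FibredAlgebra.

(** * Sums of rank-one operators with separated supports *)

Section BlockSum.
Variables (R : realType) (X : metricType R) (I : choiceType) (p : I -> X).
Local Notation C := R[i].
Local Notation L2 := (ell2 R I).
Local Open Scope complex_scope.
Variables (D : nat -> set X) (a b : nat -> L2).
Hypothesis D_disj : forall n m y, D n y -> D m y -> n = m.
Hypothesis a_supp : forall n i, ~ D n (p i) -> a n i = 0.
Hypothesis b_supp : forall n i, ~ D n (p i) -> b n i = 0.
Hypothesis a_le1 : forall n, l2norm (a n) <= 1.
Hypothesis b_le1 : forall n, l2norm (b n) <= 1.
Implicit Types (u v w : L2) (F : set I).

(** Each index lies over at most one block, so the infinite sum is given coordinatewise, without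
    convergence; square summability is proved afterwards. *)
Definition block_fun u (i : I) : C :=
  if pselect (exists n, D n (p i)) is left h then
    rank_one (a (projT1 (cid h))) (b (projT1 (cid h))) u i
  else 0.

Lemma block_funE u n i : D n (p i) -> block_fun u i = rank_one (a n) (b n) u i.
Proof.
move=> Dn; rewrite /block_fun; case: pselect => [h|[]]; last by exists n.
by case: (cid h) => m Dm /=; rewrite (D_disj Dn Dm).
Qed.

Lemma block_fun_out u i : (forall n, ~ D n (p i)) -> block_fun u i = 0.
Proof.
by move=> h; rewrite /block_fun; case: pselect => // h'; have [n /h] := h'.
Qed.

Let partial_block u N := \sum_(n < N) rank_one (a n) (b n) u.
Let dom N := [set i | exists2 n, (n < N)%N & D n (p i)].

Let partial_blockS u N :
  partial_block u N.+1 = partial_block u N + rank_one (a N) (b N) u.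
Proof. by rewrite /partial_block big_ord_recr. Qed.

Let partial_block_out u N i : ~ dom N i -> partial_block u N i = 0.
Proof.
elim: N => [|N IH] h; first by rewrite /partial_block big_ord0.
rewrite partial_blockS ell2DE IH ?add0r; last first.
  by move=> [n nN Dn]; apply: h; exists n => //; exact: ltnW.
by rewrite ell2ZE a_supp ?mulr0 // => DN; apply: h; exists N.
Qed.

Let partial_block_in u N n i : (n < N)%N -> D n (p i) ->
  partial_block u N i = rank_one (a n) (b n) u i.
Proof.
elim: N => // N IH; rewrite ltnS leq_eqVlt => /orP[/eqP ->|nN] Dn;
    rewrite partial_blockS ell2DE.
  rewrite partial_block_out ?add0r // => -[m mN Dm].
  by move: mN; rewrite (D_disj Dm Dn) ltnn.
rewrite IH // [X in _ + X]ell2ZE a_supp ?mulr0 ?addr0 // => DN.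
by move: nN; rewrite (D_disj Dn DN) ltnn.
Qed.

Let nsq_block u n :
  nsq (rank_one (a n) (b n) u) <= nsq (mask [set i | D n (p i)] u).
Proof.
have hb : mask [set i | D n (p i)] (b n) = b n.
  by apply: mask_id => i /=; exact: b_supp.
rewrite -le_l2norm.
have -> : rank_one (a n) (b n) u =
    rank_one (a n) (b n) (mask [set i | D n (p i)] u).
  by rewrite /rank_one l2dot_mask hb.
rewrite (le_trans (l2norm_rank_one _ _ _)) // -[leRHS]mul1r.
by rewrite ler_wpM2r ?l2norm_ge0 // -[leRHS]mul1r ler_pM ?l2norm_ge0.
Qed.

(** The blocks are disjoint on the input as well as on the output side, and each rank-one term is a
    contraction, so Pythagoras adds up the bounds. *)
Let nsq_partial_block u N : nsq (partial_block u N) <= nsq (mask (dom N) u).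
Proof.
elim: N => [|N IH].
  by rewrite /partial_block big_ord0 -sqr_l2norm l2norm0 expr0n nsq_ge0.
have disj i : dom N i -> ~ D N (p i).
  by move=> [n nN Dn] DN; move: nN; rewrite (D_disj Dn DN) ltnn.
have -> : mask (dom N.+1) u = mask (dom N) u + mask [set i | D N (p i)] u.
  apply: ell2_eqP => i; rewrite ell2DE.
  have [h|h] := pselect (dom N i).
    rewrite [X in _ + X]maskE_out ?addr0 /=; last exact: disj.
    rewrite !maskE_in //; case: h => n nN Dn; exists n => //; exact: ltnW.
  rewrite [X in X + _]maskE_out // add0r; have [h'|h'] := pselect (D N (p i)).
    by rewrite !maskE_in //; exists N.
  rewrite !maskE_out // => -[n]; rewrite ltnS leq_eqVlt => /orP[/eqP->//|nN Dn].
  by apply: h; exists n.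
rewrite partial_blockS !nsq_disjoint ?lerD // => i; last first.
  have [h|h] := pselect (dom N i).
    by right; rewrite maskE_out //=; exact: disj.
  by left; rewrite maskE_out.
have [h|h] := pselect (dom N i); last by left; exact: partial_block_out.
by right; rewrite ell2ZE a_supp ?mulr0 //; exact: disj.
Qed.

Let block_funP u : exists2 v : L2, (forall i, v i = block_fun u i) &
  l2norm v <= l2norm u.
Proof.
have key F : finite_set F -> \sum_(i \in F) sqmod (block_fun u i) <= nsq u.
  move=> finF.
  (* A finite set of indices meets finitely many blocks, so on [F] the infinite sum agrees with a
     partial one. *)
  have [N hN] : exists N, forall i n, F i -> D n (p i) -> (n < N)%N.
    elim/finite_set_ind: finF => [|A i _ _ [N hN]]; first by exists 0%N.
    have [[m Dm]|h] := pselect (exists n, D n (p i)); last first.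
      by exists N => j n [->|Aj] Dn; [case: h; exists n|exact: hN Aj Dn].
    exists (maxn N m.+1) => j n [->|Aj] Dn; rewrite leq_max.
      by rewrite (D_disj Dn Dm) ltnSn orbT.
    by rewrite (hN _ _ Aj Dn).
  apply: (@le_trans _ _ (nsq (partial_block u N))).
    apply: le_trans (nsq_fsum_le _ finF).
    rewrite le_eqVlt; apply/orP; left; apply/eqP.
    apply: eq_fsbigr => i /set_mem Fi.
    have [[n Dn]|h] := pselect (exists n, D n (p i)).
      by rewrite (block_funE _ Dn) (partial_block_in _ (hN _ _ Fi Dn) Dn).
    rewrite block_fun_out; last by move=> n Dn; apply: h; exists n.
    by rewrite partial_block_out // => -[n _ Dn]; apply: h; exists n.
  by rewrite (le_trans (nsq_partial_block _ _)) // -le_l2norm l2norm_mask.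
have bP : block_fun u \in ell2_pred (R := R) (I := I).
  by apply/ell2P; exists (nsq u) => A finA; rewrite fsumEFin // lee_fin key.
by exists (Ell2 bP) => //; rewrite le_l2norm; apply: nsq_le.
Qed.

Definition block_sum u : L2 := s2val (cid2 (block_funP u)).

Lemma block_sumE u i : block_sum u i = block_fun u i.
Proof. by rewrite /block_sum; case: cid2. Qed.

Lemma l2norm_block_sum u : l2norm (block_sum u) <= l2norm u.
Proof. by rewrite /block_sum; case: cid2. Qed.

Lemma block_sum_linear : linear block_sum.
Proof.
move=> k u v; apply: ell2_eqP => i; rewrite ell2DE ell2ZE !block_sumE.
have [[n Dn]|h] := pselect (exists n, D n (p i)).
  by rewrite !(block_funE _ Dn) rank_one_linear.
by rewrite !block_fun_out ?mulr0 ?addr0 // => n Dn; apply: h; exists n.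
Qed.

Lemma block_sum_bounded : bounded_op block_sum.
Proof.
split; first exact: block_sum_linear.
by exists 1 => u; rewrite mul1r l2norm_block_sum.
Qed.

Lemma mask_block_sum n u :
  mask [set i | D n (p i)] (block_sum u) = rank_one (a n) (b n) u.
Proof.
apply: ell2_eqP => i; have [Dn|Dn] := pselect (D n (p i)).
  by rewrite maskE_in // block_sumE (block_funE _ Dn).
by rewrite maskE_out // ell2ZE a_supp ?mulr0.
Qed.

Lemma block_sum_supp n u : (forall i, ~ D n (p i) -> u i = 0) ->
  block_sum u = rank_one (a n) (b n) u.
Proof.
move=> hu; rewrite -mask_block_sum mask_id // => i /= Dn.
rewrite block_sumE.
have [[m Dm]|h] := pselect (exists n, D n (p i)); last first.
  by rewrite block_fun_out // => m Dm; apply: h; exists m.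
rewrite (block_funE _ Dm) /rank_one.
have -> : u = mask [set i | D n (p i)] u by rewrite mask_id.
rewrite l2dot_mask mask_eq0; first by rewrite l2dot0r scale0r.
move=> j /= Dj; apply: b_supp => Dmj; apply: Dn.
by rewrite (D_disj Dj Dmj).
Qed.

(** Every nonzero entry stays inside one block, so [t] bounds the propagation, and the entry is of
    rank one. *)
Lemma block_sum_fibred_roe (t : R) :
  (forall n y y', D n y -> D n y' -> mdist y y' <= t) ->
  fibred_roe_algebra p block_sum.
Proof.
move=> diamD; apply: locally_compact_sub.
have entry x y : (op_entry p block_sum x y = fun=> 0) \/
    exists n, [/\ D n x, D n y & op_entry p block_sum x y =
      rank_one (mask (p @^-1` [set y]) (a n)) (mask (p @^-1` [set x]) (b n))].
  have [[n Dn]|h] := pselect (exists n, D n y); last first.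
    left; apply/funext => u; apply: mask_eq0 => i /= iy.
    by rewrite block_sumE block_fun_out // iy => n Dn; apply: h; exists n.
  have e : op_entry p block_sum x y =
      rank_one (mask (p @^-1` [set y]) (a n)) (mask (p @^-1` [set x]) (b n)).
    rewrite -op_entry_rank_one; apply/funext => u.
    rewrite /op_entry /= -mask_block_sum mask_mask; congr mask.
    by apply/seteqP; split=> [i /= iy|i []//]; split=> //=; rewrite iy.
  have [Dx|Dx] := pselect (D n x); first by right; exists n.
  left; rewrite e; apply/funext => u; rewrite /rank_one.
  have -> : mask (p @^-1` [set x]) (b n) = 0; last first.
    by rewrite l2dot0r scale0r.
  apply: mask_eq0.
  by move=> i /= ix; apply: b_supp; rewrite ix.
split; first exact: block_sum_bounded.
  exists t => x y ne; have [e|[n [Dx Dy _]]] := entry x y; first by case: ne.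
  exact: diamD Dx Dy.
move=> x y; have [->|[n [_ _ ->]]] := entry x y; last exact: compact_rank_one.
rewrite (_ : (fun=> 0) = rank_one (0 : L2) 0); first exact: compact_rank_one.
by apply/funext => u; rewrite /rank_one scaler0.
Qed.

End BlockSum.

(** * Greedy choice of far apart points *)

Section Separated.
Variables (R : realType) (X : metricType R).
Hypothesis X_lf : forall (x : X) (r : R), finite_set [set y | mdist x y <= r].

Lemma separated_sequence (W : Type) (c : W -> X) (P : nat -> set W) (r : R) :
  (forall n F, finite_set F -> exists2 w, P n w & ~ F (c w)) ->
  exists w_ : nat -> W, (forall n, P n (w_ n)) /\
    forall n m, n != m -> r < mdist (c (w_ n)) (c (w_ m)).
Proof.
move=> hP.
(* [near_ s] is what the next centre has to avoid, a finite union of finite balls. Positions in the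
   list replace membership because [W] is a bare type. *)
pose near_ (s : seq W) := \bigcup_(k in [set k | (k < size s)%N])
  [set y | exists2 w, onth s k = Some w & mdist (c w) y <= r].
have near_fin s : finite_set (near_ s).
  elim: s => [|w s IH].
    by rewrite (_ : near_ [::] = set0) //; apply/seteqP; split=> // y [].
  apply: (@sub_finite_set _ _ ([set y | mdist (c w) y <= r] `|` near_ s)).
    move=> y [[|k] /= ks [w' e h]]; first by left; case: e => ->.
    by right; exists k => //; exists w'.
  by rewrite finite_setU; split; [exact: X_lf|].
pose pick n s := s2val (cid2 (hP n _ (near_fin s))).
(* [L n] lists the first [n] choices, the latest first. *)
pose L := fix L n := if n is m.+1 then pick m (L m) :: L m else [::].
pose w_ n := pick n (L n).
have wP n : P n (w_ n) by rewrite /w_ /pick; case: cid2.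
have wn n : ~ near_ (L n) (c (w_ n)) by rewrite /w_ /pick; case: cid2.
have memL n m : (m < n)%N ->
    exists2 k, (k < size (L n))%N & onth (L n) k = Some (w_ m).
  elim: n => // n IH; rewrite ltnS leq_eqVlt => /orP[/eqP ->|/IH[k k1 k2]].
    by exists 0%N.
  by exists k.+1.
have lt n m : (m < n)%N -> r < mdist (c (w_ m)) (c (w_ n)).
  move=> mn; rewrite ltNge; apply/negP => h; apply: (wn n).
  by have [k kn ke] := memL _ _ mn; exists k => //; exists (w_ m).
exists w_; split=> // n m; rewrite neq_ltn => /orP[/lt //|/lt].
by rewrite metric_sym.
Qed.

End Separated.

(** * Spatial implementation of isomorphisms *)

Section Spatial.
Variables (R : realType) (X Y : metricType R) (I J : choiceType).
Variables (p : I -> X) (q : J -> Y).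
Local Notation C := R[i].
Local Open Scope complex_scope.

Record spatial (U : ell2 R I -> ell2 R J) (V : ell2 R J -> ell2 R I) : Prop :=
  Spatial {
    spatial_lin : linear U;
    spatialK : cancel U V;
    spatialVK : cancel V U;
    spatial_nsq : forall u, nsq (U u) = nsq u;
    spatial_to : forall a,
      fibred_roe_algebra p a -> fibred_roe_algebra q (U \o a \o V);
    spatial_from : forall b,
      fibred_roe_algebra q b -> fibred_roe_algebra p (V \o b \o U) }.

(* Fix a unit vector [e] in the range of the image of the rank-one projection on
   [delta i0]; the unitary maps [u] to the value at [e] of the image of the
   rank-one operator that maps [delta i0] to [u].  This needs no continuity of
   the isomorphism. *)
Lemma star_isomorphic_spatial (i0 : I) :
  star_isomorphic (fibred_roe_algebra p) (fibred_roe_algebra q) ->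
  exists U V, spatial U V.
Proof.
move=> [Phi [[PhiA Phi_inj Phi_surj] Phi_lin Phi_mul Phi_adj]].
pose d := delta R i0; pose th u := rank_one u d.
have Ath u : fibred_roe_algebra p (th u) by exact: fibred_roe_rank_one.
have zeroE : (fun=> 0) = rank_one (0 : ell2 R I) 0.
  by apply/funext => u; rewrite /rank_one scaler0.
have A0 : fibred_roe_algebra p (fun=> 0).
  by rewrite zeroE; exact: fibred_roe_rank_one.
have Phi0 v : Phi (fun=> 0) v = 0.
  have := Phi_lin 1 _ _ A0 A0; under eq_fun do rewrite scaler0 addr0.
  move=> /(congr1 (fun f => f v)); rewrite scale1r => /eqP.
  by rewrite -subr_eq0 opprD addrA subrr sub0r oppr_eq0 => /eqP.
have PhiZ k a v : fibred_roe_algebra p a ->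
    Phi (fun w => k *: a w) v = k *: Phi a v.
  move=> Aa; have := Phi_lin k _ _ Aa A0; under eq_fun do rewrite addr0.
  by move=> ->; rewrite Phi0 addr0.
have thth u v w : rank_one v u (th u w) = (nsq u)%:C *: th v w.
  by rewrite /th /rank_one l2dotZl l2dot_self scalerA mulrC.
have dd : nsq d = 1 by exact: nsq_delta.
(* [th d] is a nonzero idempotent and [Phi] is injective, so its image is one too; [e] is a unit
   vector that the image fixes. *)
have [v1 Ev1] : exists v, Phi (th d) v != 0.
  apply: contrapT => /forallNP h.
  have /Phi_inj : Phi (th d) = Phi (fun=> 0).
    by apply/funext => v; rewrite Phi0; apply/eqP/negPn/negP => /h.
  rewrite !inE => /(_ (Ath _) A0).
  move=> /(congr1 (fun f : ell2 R I -> ell2 R I => f d i0)).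
  rewrite /th /rank_one l2dot_self dd scale1r deltaE eqxx => /eqP.
  by rewrite oner_eq0.
have Elin u : linear (Phi (th u)).
  exact: (fibred_roe_bounded (PhiA _ (Ath u))).1.
have EE v : Phi (th d) (Phi (th d) v) = Phi (th d) v.
  have := Phi_mul _ _ (Ath d) (Ath d).
  move=> /(congr1 (fun f => f v)) /= <-; congr (Phi _ v).
  by apply/funext => w /=; rewrite [th d _]thth dd scale1r.
have n0 : 0 < l2norm (Phi (th d) v1).
  rewrite lt_neqAle l2norm_ge0 andbT eq_sym.
  by apply: contra_neq Ev1; exact: l2norm_eq0.
pose e := ((l2norm (Phi (th d) v1))^-1)%:C *: Phi (th d) v1.
have Ee : Phi (th d) e = e by rewrite (linZ (Elin d)) EE.
have e1 : nsq e = 1.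
  rewrite -sqr_l2norm l2normZ cmod_real gtr0_norm ?invr_gt0 // mulVf ?expr1n //.
  by rewrite gt_eqF.
clearbody e; pose U u := Phi (th u) e.
have Ulin : linear U.
  move=> k u v; rewrite /U -(PhiZ _ _ _ (Ath u)).
  have := Phi_lin k _ _ (Ath u) (Ath v) => /(congr1 (fun f => f e)).
  rewrite PhiZ // => <-; congr (Phi _ e); apply/funext => w.
  by rewrite /th /rank_one scalerDr !scalerA mulrC.
(* The adjoint of [th u] is [rank_one d u], and their product is [nsq u] times [th d], whose image
   fixes [e]. *)
have Unsq u : nsq (U u) = nsq u.
  apply: (@complexI R); rewrite -l2dot_self /U.
  have Aadj : fibred_roe_algebra p (rank_one d u) by exact: fibred_roe_rank_one.
  have := Phi_adj _ _ (Ath u) Aadj; rewrite /adjoint_ops => ->; last first.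
    move=> w w'; rewrite /th /rank_one l2dotZl l2dotZr mulrC.
    by congr (_ * _); rewrite l2dotC.
  have := Phi_mul _ _ Aadj (Ath u) => /(congr1 (fun f => f e)) /= <-.
  have -> : rank_one d u \o th u = fun w => (nsq u)%:C *: th d w.
    by apply/funext => w /=; rewrite thth.
  rewrite (PhiZ _ _ _ (Ath d)) Ee l2dotZr l2dot_self e1 mulr1.
  by rewrite -[LHS]/(conjc _) conjc_real.
have inter a u : fibred_roe_algebra p a -> Phi a (U u) = U (a u).
  move=> Aa; rewrite /U; have := Phi_mul _ _ Aa (Ath u).
  move=> /(congr1 (fun f => f e)) /= <-; congr (Phi _ e).
  apply/funext => w /=.
  by rewrite /th /rank_one (linZ (fibred_roe_bounded Aa).1).
(* A rank-one operator that maps [e] to [v], built from a nonzero coordinate of [e], is some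
   [Phi a]; as [U d = e], the vector [a d] is a preimage of [v]. *)
have Usurj v : exists u, U u = v.
  have [j ej] : exists j, e j != 0.
    apply: contrapT => /forallNP h; move: e1; have -> : e = 0.
      by apply: ell2_eqP => j; apply/eqP/negPn/negP => /h.
    by rewrite -sqr_l2norm l2norm0 expr0n => /eqP; rewrite eq_sym oner_eq0.
  have Bb := fibred_roe_rank_one q ((e j)^-1 *: v) (delta R j).
  have [a Aa ab] := Phi_surj _ Bb.
  exists (a d); rewrite -inter // /U Ee ab /rank_one l2dot_delta.
  by rewrite scalerA mulfV // scale1r.
have Uinj u v : U u = U v -> u = v.
  move=> uv; apply/eqP; rewrite -subr_eq0; apply/eqP; apply: nsq_eq0.
  by rewrite -Unsq (linB Ulin) uv subrr -sqr_l2norm l2norm0 expr0n.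
pose V v := sval (cid (Usurj v)).
have UV v : U (V v) = v by rewrite /V; case: cid.
exists U, V; split; [exact: Ulin| |exact: UV|exact: Unsq| |].
- by move=> u; apply: Uinj; rewrite UV.
- move=> a Aa; rewrite (_ : _ \o _ = Phi a); first exact: PhiA.
  by apply/funext => v /=; rewrite -inter // UV.
- move=> b Bb; have [a Aa <-] := Phi_surj _ Bb.
  rewrite (_ : _ \o _ = a) //; apply/funext => u /=.
  by rewrite inter //; apply: Uinj; rewrite UV.
Qed.

End Spatial.

Section SpatialTheory.
Variables (R : realType) (X Y : metricType R) (I J : choiceType).
Variables (p : I -> X) (q : J -> Y).
Local Open Scope complex_scope.
Variables (U : ell2 R I -> ell2 R J) (V : ell2 R J -> ell2 R I).
Hypothesis UV : spatial p q U V.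

Let Ulin := spatial_lin UV.
Let UK := spatialK UV.
Let VK := spatialVK UV.

Lemma spatial_sym : spatial q p V U.
Proof.
split=> //; [|by move=> v; rewrite -(spatial_nsq UV) VK|
  exact: (spatial_from UV)|exact: (spatial_to UV)].
move=> k u v; apply: (can_inj UK).
by rewrite (linD Ulin) (linZ Ulin) !VK.
Qed.

Lemma spatial_l2norm u : l2norm (U u) = l2norm u.
Proof. by rewrite /l2norm -!/(nsq _) (spatial_nsq UV). Qed.

(** By polarization, the inverse of a linear isometry is its adjoint. *)
Lemma spatial_dot u v : l2dot (U u) v = l2dot u (V v).
Proof.
rewrite -{1}(VK v) !l2dot_polar /polar.
rewrite -!(linZ Ulin) -!(linN Ulin) -!(linD Ulin).
by rewrite !(spatial_nsq UV).
Qed.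

End SpatialTheory.

(** * Uniform approximability and concentration *)

Section Signs.
Variables (R : realType) (I J : choiceType).

(* The signs are [1] on [M] and [-1] on [F `\` M].  By the parallelogram law,
   each new term can be given a sign for which the square norm grows by at most
   the square norm of the term. *)
Lemma exists_signs (W : ell2 R J -> ell2 R I) (c : R) (u : ell2 R J)
    (F : set J) :
  linear W -> (forall j, nsq (W (delta R j)) <= c) -> finite_set F ->
  exists2 M, M `<=` F &
    nsq (W (mask M u - mask (F `\` M) u)) <= c * nsq (mask F u).
Proof.
move=> Wl Wc; elim/finite_set_ind => [|A j _ Aj [M MA hM]].
  exists set0 => //; rewrite set0D !mask_eq0 // subr0 (lin0 Wl).
  by rewrite -!sqr_l2norm !l2norm0 expr0n mulr0.
set z := W _ in hM; pose y := W (u j *: delta R j).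
have hy : nsq y <= c * nsq (u j *: delta R j).
  by rewrite /y (linZ Wl) !nsqZ mulrCA ler_wpM2l ?sqmod_ge0 // nsq_delta mulr1.
have hF : nsq (mask (j |` A) u) = nsq (u j *: delta R j) + nsq (mask A u).
  rewrite mask_setU1 // nsq_disjoint // => i; rewrite ell2ZE deltaE.
  by case: eqP => [->|_]; [right; rewrite maskE_out|left; rewrite mulr0].
have Mj : ~ M j by move=> /MA.
have zy : nsq (z + y) + nsq (z - y) <= 2 * (c * nsq (mask (j |` A) u)).
  by rewrite nsq_par hF; lra.
have [le1|le2] : nsq (z + y) <= c * nsq (mask (j |` A) u) \/
                 nsq (z - y) <= c * nsq (mask (j |` A) u).
- have [h|h] := leP (nsq (z + y)) (c * nsq (mask (j |` A) u)); first by left.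
  by right; lra.
- exists (j |` M); first by apply: setUS.
  rewrite (_ : (_ `\` _) = A `\` M); last first.
    apply/seteqP; split=> i [].
      by move=> [->|Ai] h; [case: h; left|split=> // Mi; apply: h; right].
    by move=> Ai nMi; split; [right|case=> [ij|//]; rewrite ij in Ai].
  by rewrite mask_setU1 // -addrA addrC (linD Wl).
- exists M; first by move=> i /MA; right.
  rewrite (_ : (_ `\` _) = j |` (A `\` M)); last first.
    apply/seteqP; split=> i; first by move=> [[->|Ai] h]; [left|right].
    by move=> [->|[Ai nMi]]; split=> //; [left|right].
  by rewrite mask_setU1; [rewrite opprD addrCA addrC (linB Wl)|case].
Qed.

End Signs.

(** * Baire category for subsets of an index set *)

Section Baire.
Variables (R : realType) (I : choiceType).

(** For finite [F], the sets [M] with [agree F s M] form a basic open set, a cylinder, of the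
    product topology on [2 ^ I]. *)
Definition agree (F s M : set I) := forall i, F i -> (M i <-> s i).

(* The Baire category theorem for [2 ^ I], for a cover by countably many closed
   sets. *)
Lemma cylinder_baire (P : nat -> set I -> Prop) :
  (forall M, exists n, P n M) ->
  (forall n M, ~ P n M ->
     exists2 F, finite_set F & forall M', agree F M M' -> ~ P n M') ->
  exists n F s, finite_set F /\ forall M, agree F s M -> P n M.
Proof.
move=> cover closedP; apply: contrapT => noP.
(* If no cylinder lies inside [P n], each one contains a smaller cylinder disjoint from [P n]. *)
have step n (Fs : {F : set I | finite_set F} * set I) :
    exists Fs' : {F : set I | finite_set F} * set I,
    [/\ sval Fs.1 `<=` sval Fs'.1, agree (sval Fs.1) Fs.2 Fs'.2 &
        forall M, agree (sval Fs'.1) Fs'.2 M -> ~ P n M].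
  have [M [agM nPM]] : exists M, agree (sval Fs.1) Fs.2 M /\ ~ P n M.
    apply: contrapT => /forallNP h; apply: noP; exists n, (sval Fs.1), Fs.2.
    split; first exact: svalP.
    by move=> M agM; apply: contrapT => nPM; apply: (h M).
  have [F finF hF] := closedP n M nPM.
  have finU : finite_set (sval Fs.1 `|` F).
    by rewrite finite_setU; split=> //; exact: svalP.
  exists (exist _ _ finU, M); split; [exact: subsetUl|exact: agM|].
  by move=> M' h; apply: hF => i Fi; apply: h; right.
pose S := fix S n : {F : set I | finite_set F} * set I :=
  if n is m.+1 then sval (cid (step m (S m)))
  else (exist _ _ (finite_set0 I), set0).
have Sstep n : [/\ sval (S n).1 `<=` sval (S n.+1).1,
    agree (sval (S n).1) (S n).2 (S n.+1).2 &
    forall M, agree (sval (S n.+1).1) (S n.+1).2 M -> ~ P n M].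
  by rewrite /=; case: cid.
(* [M] collects the coordinates declared true at some stage; by nesting it belongs to every
   cylinder, hence to no [P n]. *)
pose M := [set i | exists2 n, sval (S n).1 i & (S n).2 i].
have Sle n m : (n <= m)%N -> sval (S n).1 `<=` sval (S m).1 /\
    agree (sval (S n).1) (S n).2 (S m).2.
  elim: m => [|m IH]; first by rewrite leqn0 => /eqP ->; split.
  rewrite leq_eqVlt => /orP[/eqP ->|/IH[h1 h2]]; first by split.
  have [h3 h4 _] := Sstep m; split; first exact: subset_trans h3.
  by move=> i Fi; rewrite (h4 _ (h1 _ Fi)); exact: h2.
have agM n : agree (sval (S n).1) (S n).2 M.
  move=> i Fi; split=> [[m Fmi Sm]|Sn]; last by exists n.
  have [le|/ltnW le] := leqP n m; have [h1 h2] := Sle _ _ le.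
    exact/(h2 _ Fi).
  exact/(h2 _ Fmi).
have [n Pn] := cover M; have [_ _ h] := Sstep n.
exact: (h M (agM n.+1)).
Qed.

End Baire.

(** * Tail bounds uniform over all coordinate projections *)

Section TailBounds.
Variables (R : realType) (X Y : metricType R) (I J : choiceType).
Variables (p : I -> X) (q : J -> Y).
Local Open Scope complex_scope.
Variables (U : ell2 R I -> ell2 R J) (V : ell2 R J -> ell2 R I).
Hypothesis UV : spatial p q U V.

Let Ul := spatial_lin UV.
Let Vl := spatial_lin (spatial_sym UV).

Lemma tail_boundD (rho e e' r r' : R) S T :
  tail_bound q rho e r S -> tail_bound q rho e' r' T ->
  tail_bound q rho (e + e') (Num.max r r') (fun u => S u + T u).
Proof.
move=> hS hT y u hu; rewrite (linD (mask_linear _)) mulrDl.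
have sub (r1 : R) : r1 <= Num.max r r' ->
    [set i | Num.max r r' < mdist y (q i)] `<=` [set i | r1 < mdist y (q i)].
  by move=> le1 i /=; exact: le_lt_trans.
apply: le_trans (l2normD _ _) _; apply: lerD.
  apply: le_trans (hS y u hu).
  by apply: l2norm_mask_sub; apply: sub; rewrite le_max lexx.
apply: le_trans (hT y u hu).
by apply: l2norm_mask_sub; apply: sub; rewrite le_max lexx orbT.
Qed.

Lemma tail_boundN (rho e r : R) T :
  tail_bound q rho e r T -> tail_bound q rho e r (fun u => - T u).
Proof. by move=> h y u hu; rewrite (linN (mask_linear _)) l2normN h. Qed.

Lemma tail_bound_weaken (rho e e' r r' : R) T : e <= e' -> r <= r' ->
  tail_bound q rho e r T -> tail_bound q rho e' r' T.
Proof.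
move=> ee rr h y u hu; have := h y u hu => hy.
have {}hy : l2norm (mask [set i | r < mdist y (q i)] (T u)) <= e' * l2norm u.
  by apply: le_trans hy _; rewrite ler_wpM2r // l2norm_ge0.
apply: le_trans hy.
by apply: l2norm_mask_sub => i /=; exact: le_lt_trans.
Qed.

(** The constraints on [F] are lifted one coordinate at a time. A set that violates the constraint
    at [x] differs by [x] alone from one that respects it, and the resulting correction is a single
    element of the algebra with its own tail bound. *)
Lemma tail_bound_cylinder (T : ell2 R I -> ell2 R I) (rho : R) F :
  fibred_roe_algebra p T -> finite_set F -> forall s (e1 e2 : R), 0 < e2 ->
  (exists r, forall M, agree F s M ->
     tail_bound q rho e1 r (fun u => U (mask M (T (V u))))) ->
  exists r, forall M,
    tail_bound q rho (e1 + e2) r (fun u => U (mask M (T (V u)))).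
Proof.
move=> AT; elim/finite_set_ind => [|A x _ Ax IH] s e1 e2 e20 [r hr].
  exists r => M; apply: tail_bound_weaken (hr M _) => //.
  by rewrite lerDl ltW.
have e22 : 0 < e2 / 2 by rewrite divr_gt0.
have Ax1 : fibred_roe_algebra q (U \o (mask [set x] \o T) \o V).
  exact/(spatial_to UV)/fibred_roe_mask.
have [rx hx] := fibred_roe_tail rho Ax1 e22.
(* Half of [e2] pays for the coordinate [x], the other half for the rest of [F]. *)
rewrite (splitr e2) addrA; apply: (IH s) => //; exists (Num.max r rx) => M agM.
have [sx|sx] := pselect (s x); have [Mx|Mx] := pselect (M x).
- apply: tail_bound_weaken (hr M _); rewrite ?lerDl ?(ltW e22) ?le_max ?lexx //.
  by move=> i [->//|/agM].
- have -> : (fun u => U (mask M (T (V u)))) =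
      (fun u => U (mask (x |` M) (T (V u))) - U (mask [set x] (T (V u)))).
    by apply/funext => u; rewrite mask_setU1 // mask_set1 (linD Ul) addrC addKr.
  apply: tail_boundD; last exact: tail_boundN.
  apply: hr => i [->|Ai]; first by split=> // _; left.
  rewrite -(agM _ Ai); split=> [[ix|//]|]; last by right.
  by rewrite ix in Ai.
- have -> : (fun u => U (mask M (T (V u)))) =
      (fun u => U (mask (M `\ x) (T (V u))) + U (mask [set x] (T (V u)))).
    apply/funext => u; rewrite -(linD Ul); congr U.
    rewrite mask_set1 addrC -mask_setU1 //; last by move=> -[_ []].
    congr (mask _ _); apply/seteqP; split=> i; last by case=> [->|[]].
    by move=> Mi; have [->|ix] := pselect (i = x); [left|right].
  apply: tail_boundD; last exact: hx.
  apply: hr => i [->|Ai]; first by split=> // -[_]; case.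
  rewrite -(agM _ Ai); split=> [[]//|Mi]; split=> // ix.
  by rewrite ix in Ai.
- apply: tail_bound_weaken (hr M _); rewrite ?lerDl ?(ltW e22) ?le_max ?lexx //.
  by move=> i [->//|/agM].
Qed.

(** Each [M] has some radius, because [mask M \o T] stays in the algebra. Natural radii give
    countably many closed conditions on [M]; by Baire one of them holds on a cylinder, and
    [tail_bound_cylinder] extends it to all [M]. *)
Lemma tail_bound_uniform (T : ell2 R I -> ell2 R I) (rho e : R) :
  fibred_roe_algebra p T -> 0 < e ->
  exists r, forall M, tail_bound q rho e r (U \o (mask M \o T) \o V).
Proof.
move=> AT e0; have e2 : 0 < e / 2 by rewrite divr_gt0.
have AM M : fibred_roe_algebra q (U \o (mask M \o T) \o V).
  exact/(spatial_to UV)/fibred_roe_mask.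
pose P (n : nat) M := tail_bound q rho (e / 2) n%:R (U \o (mask M \o T) \o V).
have cover M : exists n, P n M.
  have [r hr] := fibred_roe_tail rho (AM M) e2.
  have [n rn] : exists n : nat, r <= n%:R.
    by exists (Num.truncn r).+1; exact/ltW/truncnS_gt.
  by exists n; exact: tail_bound_weaken hr.
have closedP n M : ~ P n M -> exists2 F, finite_set F &
    forall M', agree F M M' -> ~ P n M'.
  move=> /existsNP[y /existsNP[u /not_implyP[hu /negP]]]; rewrite -ltNge /=.
  set D := [set i | _]; set d := l2norm (mask D _) => lt_d.
  (* A violation is strict. Changing [M] where [T (V u)] has tail at most half the gap preserves it,
     so the condition is closed. *)
  have [|F finF hF] := @l2norm_trunc _ _ (T (V u)) ((d - e / 2 * l2norm u) / 2).
    by rewrite divr_gt0 // subr_gt0.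
  exists F => // M' agM /(_ y u hu) /=; apply/negP; rewrite -ltNge -/D.
  have dE : d = l2norm (mask D (U (mask M (T (V u))))) by [].
  have : d <= l2norm (mask D (U (mask M' (T (V u))))) +
      (d - e / 2 * l2norm u) / 2.
    rewrite {1}dE -[U (mask M _)](subrK (U (mask M' (T (V u))))).
    rewrite addrC (linD (mask_linear _)) (le_trans (l2normD _ _)) // lerD2l.
    rewrite (le_trans (l2norm_mask _ _)) // -(linB Ul) (spatial_l2norm UV).
    apply: le_trans hF; rewrite le_l2norm.
    apply: nsq_mono => i; rewrite ell2DE ell2NE !maskE in_setC.
    have [Fi|Fi] := boolP (i \in F) => /=.
      suff -> : (i \in M) = (i \in M') by rewrite subrr.
      by apply/idP/idP => /set_mem Mi; apply/mem_set/(agM _ (set_mem Fi)).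
    by case: ifP; case: ifP => _ _; rewrite ?subrr ?subr0 ?sub0r ?sqmodN;
      rewrite ?sqmod0 ?sqmod_ge0.
  rewrite -lerBlDr => h; apply: lt_le_trans h; lra.
have [n [F [s [finF hF]]]] := cylinder_baire cover closedP.
rewrite (splitr e); apply: (@tail_bound_cylinder T rho F AT finF s _ _ e2).
by exists n%:R.
Qed.

End TailBounds.

(** * Basis vectors with mass near a given point *)

Section Concentration.
Variables (R : realType) (X Y : metricType R) (I J : choiceType).
Variables (p : I -> X) (q : J -> Y).
Local Open Scope complex_scope.
Variables (U : ell2 R I -> ell2 R J) (V : ell2 R J -> ell2 R I).
Hypothesis UV : spatial p q U V.

Let Ul := spatial_lin UV.
Let Vl := spatial_lin (spatial_sym UV).

Definition concentrated (r : R) (sigma : X -> J) := forall x,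
  4^-1 <= l2norm (mask [set i | mdist x (p i) <= r] (V (delta R (sigma x)))).

(* With [T] the conjugate of the projection on one basis vector per fibre, the
   vectors [V (mask M (U (delta i)))] are almost supported near [x], uniformly
   in [M].  A choice of signs as in [exists_signs] preserves the norm of their
   combination, so that some [V (delta j)] has mass near [x]. *)
Lemma exists_concentrated (i_ : X -> I) : cancel i_ p ->
  exists r : R, 0 <= r /\ exists sigma, concentrated r sigma.
Proof.
move=> i_K; pose P := mask (R := R) (range i_).
have AP : fibred_roe_algebra p P.
  by apply: transversal_mask => _ _ [x _ <-] [y _ <-]; rewrite !i_K => ->.
(* The value [6^-1] bounds the truncation error and both tails; the contradiction is that [1 - 6^-1]
   exceeds [4^-1 + 6^-1 + 6^-1]. *)
have e0 : 0 < 6^-1 :> R by rewrite invr_gt0.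
have sqr4V : 4^-1 ^+ 2 = 16^-1 :> R by rewrite exprVn -natrX.
(* The roles of [U] and [V] are exchanged, with [U \o P \o V] as the operator; the radius 0 suffices
   since [delta (i_ x)] sits over one point. *)
have [r hr] := tail_bound_uniform (spatial_sym UV) 0 (spatial_to UV AP) e0.
exists (Num.max 0 r); split; first by rewrite le_max lexx.
suff : forall x, exists j, 4^-1 <=
    l2norm (mask [set i | mdist x (p i) <= Num.max 0 r] (V (delta R j))).
  by move=> /choice[sigma h]; exists sigma.
move=> x; apply: contrapT => /forallNP h.
set B := [set i | _] in h; pose d := delta R (i_ x); pose u := U d.
have tail M : l2norm (mask (~` B) (V (mask M u))) <= 6^-1.
  have := hr M x d; rewrite /= (spatialK UV) l2norm_delta mulr1.
  have -> : P d = d.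
    apply: mask_id => k nk; rewrite deltaE.
    by case: eqP nk => // -> []; exists x.
  move=> h6; apply: le_trans (h6 _); last first.
    by move=> k; rewrite deltaE; case: eqP => // ->; rewrite i_K mdistxx ltxx.
  apply: l2norm_mask_sub => i /= /negP; rewrite -ltNge gt_max.
  by case/andP.
have u1 : l2norm u = 1.
  by rewrite (spatial_l2norm UV) l2norm_delta.
have [F finF hF] := l2norm_trunc u e0.
have WB : linear (fun v => mask B (V v)).
  by move=> k v w; rewrite Vl mask_linear.
have [|M MF] := @exists_signs R I J _ (16^-1) u F WB _ finF.
  move=> j; have /negP := h j; rewrite -ltNge => /ltW.
  by rewrite l2norm_le ?invr_ge0 // sqr4V.
set z := _ - _ => hz.
have nz : nsq z = nsq (mask F u).
  rewrite /z nsq_disjoint; last first.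
    move=> i; have [Mi|Mi] := pselect (M i); last by left; rewrite maskE_out.
    by right; rewrite ell2NE maskE_out ?oppr0 // => -[].
  rewrite nsqN -nsq_disjoint; last first.
    move=> i; have [Mi|Mi] := pselect (M i); last by left; rewrite maskE_out.
    by right; rewrite maskE_out // => -[].
  congr nsq; apply: ell2_eqP => i; rewrite ell2DE.
  have [Mi|Mi] := pselect (M i).
    rewrite [X in _ + X]maskE_out ?addr0; last by case.
    by rewrite !maskE_in //; exact: MF.
  rewrite [X in X + _]maskE_out // add0r.
  have [Fi|Fi] := pselect (F i); first by rewrite !maskE_in.
  by rewrite !maskE_out // => -[].
have z56 : 1 - 6^-1 <= l2norm z.
  have -> : l2norm z = l2norm (mask F u) by rewrite /l2norm -!/(nsq _) nz.
  by have := l2normD (mask F u) (mask (~` F) u); rewrite mask_setC u1; lra.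
have z14 : l2norm (mask B (V z)) <= 4^-1.
  rewrite l2norm_le ?invr_ge0 // (le_trans hz) //.
  have : nsq (mask F u) <= 1.
    by rewrite -(expr1n _ 2) -l2norm_le // -u1 l2norm_mask.
  rewrite sqr4V; have : 0 < 16^-1 :> R by rewrite invr_gt0.
  by move=> ? ?; rewrite -[leRHS]mulr1 ler_wpM2l // ltW.
have : l2norm z <= l2norm (mask B (V z)) + (6^-1 + 6^-1).
  rewrite -(spatial_l2norm (spatial_sym UV)) -{1}(mask_setC B (V z)).
  rewrite (le_trans (l2normD _ _)) // lerD2l.
  rewrite /z (linB Vl) (linB (mask_linear _)).
  by rewrite (le_trans (l2normB _ _)) // lerD.
lra.
Qed.

Section Link.
Hypothesis X_lf : forall (x : X) (r : R), finite_set [set y | mdist x y <= r].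

(* Otherwise the operators of rank one given by the [a w] and [b w], for a
   sequence of [w] with separated blocks, add up to an element of the algebra
   whose image violates the uniform bound of [tail_bound_uniform]. *)
Lemma bounded_link (W : Type) (c : W -> X) (y y' : W -> Y)
    (a b : W -> ell2 R I) (rho r k : R) :
  0 < k ->
  (forall w i, rho < mdist (c w) (p i) -> a w i = 0) ->
  (forall w i, rho < mdist (c w) (p i) -> b w i = 0) ->
  (forall w, l2norm (a w) <= 1) -> (forall w, l2norm (b w) <= 1) ->
  (forall w, k <= l2norm (mask [set j | mdist (y w) (q j) <= r] (U (a w)))) ->
  (forall w, k <= l2norm (mask [set j | mdist (y' w) (q j) <= r] (U (b w)))) ->
  (forall x, exists m, forall w, c w = x -> mdist (y w) (y' w) <= m) ->
  exists m, forall w, mdist (y w) (y' w) <= m.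
Proof.
move=> k0 ha hb a1 b1 ka kb hm; apply: contrapT => /forallNP unb.
pose mm x := sval (cid (hm x)).
have hmm w : mdist (y w) (y' w) <= mm (c w).
  by rewrite /mm; case: cid => m /= ->.
pose P n := [set w | n%:R < mdist (y w) (y' w)].
(* Over finitely many centres the distances are bounded by [hm], so a larger distance forces a
   centre outside [F]. *)
have [n F finF|w_ [wP wsep]] :=
    separated_sequence X_lf (c := c) (P := P) (rho + rho).
  have [m Fm] := finite_bound mm finF.
  have /existsNP[w /negP] := unb (Num.max n%:R m).
  rewrite -ltNge gt_max => /andP[nw mw].
  by exists w => // /Fm; rewrite leNgt (lt_le_trans mw).
pose D n := [set x | mdist (c (w_ n)) x <= rho].
have D_disj n m x : D n x -> D m x -> n = m.
  move=> /= Dn Dm; apply/eqP/negPn/negP => /wsep; apply/negP; rewrite -leNgt.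
  by rewrite (le_trans (metric_triangle _ x _)) // lerD // metric_sym.
have as_ n i : ~ D n (p i) -> a (w_ n) i = 0.
  by move=> /= /negP; rewrite -ltNge; exact: ha.
have bs_ n i : ~ D n (p i) -> b (w_ n) i = 0.
  by move=> /= /negP; rewrite -ltNge; exact: hb.
pose T := block_sum D_disj as_ bs_ (fun n => a1 (w_ n)) (fun n => b1 (w_ n)).
have AT : fibred_roe_algebra p T.
  apply: (@block_sum_fibred_roe _ _ _ _ _ _ _ _ _ _ _ _ (rho + rho)).
  move=> n x x' Dx Dx'.
  by rewrite (le_trans (metric_triangle _ (c (w_ n)) _)) // lerD // metric_sym.
have e0 : 0 < k ^+ 2 / 2 by rewrite divr_gt0 // exprn_gt0.
have [r' hr'] := tail_bound_uniform UV r AT e0.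
have [n rn] : exists n : nat, r' + r <= n%:R.
  by exists (Num.truncn (r' + r)).+1; exact/ltW/truncnS_gt.
set w := w_ n; set B := [set j | mdist (y' w) (q j) <= r].
pose z := mask B (U (b w)).
have z0 : 0 < l2norm z by apply: lt_le_trans k0 (kb w).
(* Since [V] is adjoint to [U], the coefficient of [V z] against [b w] is [nsq z]; thus the operator
   restricted to block [n] sends [z] to [nsq z] times [U (a w)]. *)
have := hr' [set i | D n (p i)] (y' w) z.
have -> : (U \o (mask [set i | D n (p i)] \o T) \o V) z = (nsq z)%:C *: U (a w).
  rewrite /= mask_block_sum /rank_one (linZ Ul); congr (_ *: _).
  by rewrite (spatial_dot (spatial_sym UV)) l2dot_mask_self.
have zB j : r < mdist (y' w) (q j) -> z j = 0.
  by move=> hj; rewrite maskE_out //= => /le_lt_trans/(_ hj); rewrite ltxx.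
move=> /(_ zB).
rewrite (linZ (mask_linear _)) l2normZ cmod_real ger0_norm ?nsq_ge0 //.
rewrite -sqr_l2norm expr2 mulrAC ler_pM2r //; apply/negP; rewrite -ltNge.
(* [y w] and [y' w] are more than [r' + r] apart, so the ball around [y w] lies beyond radius [r']
   from [y' w]. *)
have far : k <= l2norm (mask [set j | r' < mdist (y' w) (q j)] (U (a w))).
  apply: le_trans (ka w) _; rewrite le_l2norm; apply: nsq_mono => j.
  rewrite !maskE; case: ifPn => [/set_mem /= h|_]; last first.
    by rewrite sqmod0; case: ifP; rewrite ?sqmod0 ?sqmod_ge0.
  rewrite mem_set //=; have wn : n%:R < mdist (y w) (y' w) := wP n.
  have tri := metric_triangle (y w) (q j) (y' w).
  by move: tri; rewrite (metric_sym (q j)); lra.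
apply: (@lt_le_trans _ _ (k * k)); last first.
  by rewrite ler_pM ?(ltW k0) //; exact: kb.
by rewrite -expr2 ltr_pdivrMr // ltr_pMr ?exprn_gt0 // ltr1n.
Qed.

End Link.

End Concentration.

(** * Rigidity *)

Section ConcentrationMaps.
Variables (R : realType) (X Y : metricType R) (I J : choiceType).
Variables (p : I -> X) (q : J -> Y).
Local Open Scope complex_scope.
Variables (U : ell2 R I -> ell2 R J) (V : ell2 R J -> ell2 R I).
Hypothesis UV : spatial p q U V.
Hypothesis X_lf : forall (x : X) (r : R), finite_set [set y | mdist x y <= r].
Hypothesis Y_lf : forall (x : Y) (r : R), finite_set [set y | mdist x y <= r].

Let Ul := spatial_lin UV.
Let Vl := spatial_lin (spatial_sym UV).

Variables (r : R) (sigma : X -> J).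
Hypothesis r_ge0 : 0 <= r.
Hypothesis sigmaP : concentrated p V r sigma.

Let wave x := mask [set i | mdist x (p i) <= r] (V (delta R (sigma x))).

Let wave_supp x i : r < mdist x (p i) -> wave x i = 0.
Proof.
by move=> h; rewrite maskE_out //= => /(lt_le_trans h); rewrite ltxx.
Qed.

Let wave_le1 x : l2norm (wave x) <= 1.
Proof.
apply: le_trans (l2norm_mask _ _) _.
by rewrite (spatial_l2norm (spatial_sym UV)) l2norm_delta.
Qed.

(** A single coordinate suffices: at [sigma x], the vector [U (wave x)] has coefficient
    [nsq (wave x)], at least the square of [4^-1]. *)
Let wave_mass x (r' : R) : 0 <= r' ->
  16^-1 <= l2norm (mask [set j | mdist (q (sigma x)) (q j) <= r'] (U (wave x))).
Proof.
move=> r'0; apply: le_trans (cmod_coord _ (sigma x)).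
rewrite maskE_in /=; last by rewrite mdistxx.
rewrite -l2dot_delta (spatial_dot UV).
have -> : l2dot (wave x) (V (delta R (sigma x))) = (nsq (wave x))%:C.
  exact: l2dot_mask_self.
rewrite cmod_real ger0_norm ?nsq_ge0 // -sqr_l2norm.
have -> : 16^-1 = 4^-1 ^+ 2 :> R by rewrite exprVn -natrX.
by rewrite ler_sqr ?nnegrE ?l2norm_ge0 ?invr_ge0 //; exact: sigmaP.
Qed.

Lemma concentrated_coarse :
  coarse_map (@mdist R X) (@mdist R Y) (q \o sigma).
Proof.
move=> s s0; pose W := {w : X * X | mdist w.1 w.2 < s}.
have [m hm] : exists m, forall w : W,
    mdist (q (sigma (sval w).1)) (q (sigma (sval w).2)) <= m.
  (* Both waves of a pair lie within [r + s] of its first point, and for a fixed first point there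
     are finitely many pairs. *)
  apply: (bounded_link UV X_lf (c := fun w : W => (sval w).1)
    (y := fun w : W => q (sigma (sval w).1))
    (y' := fun w : W => q (sigma (sval w).2))
    (a := fun w : W => wave (sval w).1) (b := fun w : W => wave (sval w).2)
    (rho := r + s) (r := 0) (k := 16^-1)).
  - by rewrite invr_gt0.
  - move=> w i h; apply: wave_supp; lra.
  - move=> [[x x'] /= xx'] i h; apply: wave_supp.
    by have := metric_triangle x x' (p i); lra.
  - by [].
  - by [].
  - by move=> w; exact: wave_mass.
  - by move=> w; exact: wave_mass.
  - move=> x; have [m hm] := finite_bound
      (fun x' => mdist (q (sigma x)) (q (sigma x'))) (X_lf x s).
    by exists m => -[[x1 x2] /= /ltW h] x1x; rewrite x1x in h *; exact: hm.
exists (`|m| + 1) => [|x x' xx']; first by rewrite ltr_wpDl.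
have := hm (exist _ (x, x') xx'); rewrite /= => h.
by apply: le_lt_trans h _; rewrite ltr_pwDr // ler_norm.
Qed.

Variables (r2 : R) (tau : Y -> I).
Hypothesis r2_ge0 : 0 <= r2.
Hypothesis tauP : concentrated q U r2 tau.

(** Off a finite set [G] the vector [U (delta i)] has norm at most [8^-1], so each such ball must
    meet the image of [G] under [q]. *)
Lemma finite_concentration (i : I) :
  finite_set [set y | 4^-1 <= l2norm (mask [set j | mdist y (q j) <= r2]
    (U (delta R i)))].
Proof.
have [|G finG hG] := @l2norm_trunc _ _ (U (delta R i)) 8^-1.
  by rewrite invr_gt0.
apply: (@sub_finite_set _ _ (\bigcup_(j in G) [set y | mdist (q j) y <= r2])).
  move=> y /= hy; apply: contrapT => nG.
  have : 4^-1 <= 8^-1 :> R; last by lra.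
  apply: le_trans hy (le_trans _ hG).
  apply: l2norm_mask_sub => j /= h Gj; apply: nG.
  by exists j => //=; rewrite metric_sym.
by apply: bigcup_finite => // j _; exact: Y_lf.
Qed.

(* For infinitely many such [y], pairwise far apart, let [z] be the part of
   [U (delta (tau y))] near [y].  The rank-one operators given by the [z] add up
   to an element of the algebra; its image has coefficients bounded below at
   infinitely many basis vectors of the fibre of [x], although its entry at [x]
   is compact. *)
Lemma finite_concentration_fiber x : finite_set [set y | p (tau y) = x].
Proof.
apply: contrapT => infS; pose S := [set y | p (tau y) = x].
have [n F finF|y_ [yS ysep]] :=
    separated_sequence Y_lf (c := id) (P := fun=> S) (r2 + r2).
  apply: contrapT => h; apply: infS; apply: sub_finite_set finF => y yS.
  by apply: contrapT => Fy; apply: h; exists y.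
pose D n := [set y | mdist (y_ n) y <= r2].
have D_disj n m y : D n y -> D m y -> n = m.
  move=> /= Dn Dm; apply/eqP/negPn/negP => /ysep; apply/negP; rewrite -leNgt.
  by rewrite (le_trans (metric_triangle _ y _)) // lerD // metric_sym.
pose z n := mask [set j | mdist (y_ n) (q j) <= r2] (U (delta R (tau (y_ n)))).
have zs n j : ~ D n (q j) -> z n j = 0 by move=> h; rewrite maskE_out.
have z1 n : l2norm (z n) <= 1.
  by rewrite (le_trans (l2norm_mask _ _)) // (spatial_l2norm UV) l2norm_delta.
pose Z := block_sum D_disj zs zs z1 z1.
have AZ : fibred_roe_algebra q Z.
  apply: (@block_sum_fibred_roe _ _ _ _ _ _ _ _ _ _ _ _ (r2 + r2)).
  move=> n y y' Dy Dy'.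
  by rewrite (le_trans (metric_triangle _ (y_ n) _)) // lerD // metric_sym.
have e0 : 0 < 16^-1 * 16^-1 / 2 :> R.
  by rewrite divr_gt0 // mulr_gt0 // invr_gt0.
have [F finF hF] :=
  fibred_roe_fiber_compact (spatial_from UV AZ) e0 (X_lf x).
(* The coordinate at [tau (y_ n)] of the image of [V (z n)] is [nsq (z n) ^+ 2], at least
   [16^-1 * 16^-1], twice the tolerance allowed off [F]. *)
have yF n : F (tau (y_ n)).
  apply: contrapT => nF; have := hF (V (z n)) _ (yS n) nF.
  have Zz : Z (z n) = rank_one (z n) (z n) (z n).
    by apply: block_sum_supp => j; exact: zs.
  rewrite /= (spatialVK UV) Zz.
  rewrite /rank_one l2dot_self (linZ Vl) ell2ZE.
  have -> : V (z n) (tau (y_ n)) = (nsq (z n))%:C.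
    by rewrite -l2dot_delta (spatial_dot (spatial_sym UV)) l2dot_mask_self.
  rewrite (spatial_l2norm (spatial_sym UV)) -rmorphM /= cmod_real.
  rewrite ger0_norm ?mulr_ge0 ?nsq_ge0 // => le_e.
  have z16 : 16^-1 <= nsq (z n).
    have -> : 16^-1 = 4^-1 ^+ 2 :> R by rewrite exprVn -natrX.
    rewrite -sqr_l2norm ler_sqr ?nnegrE ?l2norm_ge0 ?invr_ge0 //.
    exact: tauP.
  have : 16^-1 * 16^-1 <= 16^-1 * 16^-1 / 2 * 1 :> R; last by lra.
  apply: le_trans (le_trans le_e _); first by rewrite ler_pM ?invr_ge0.
  by rewrite ler_wpM2l // ltW.
have finT : finite_set [set y | F (tau y)].
  apply: (@sub_finite_set _ _ (\bigcup_(i in F) [set y |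
      4^-1 <= l2norm (mask [set j | mdist y (q j) <= r2] (U (delta R i)))])).
    by move=> y Fy; exists (tau y) => //; exact: tauP.
  by apply: bigcup_finite => // i _; exact: finite_concentration.
have y_inj n m : y_ n = y_ m -> n = m.
  move=> e; apply/eqP/negPn/negP => /ysep; rewrite e mdistxx ltNge addr_ge0 //.
have [N hN] : exists N, forall n, [set y | F (tau y)] (y_ n) -> (n < N)%N.
  elim/finite_set_ind: finT => [|A y _ _ [N hN]]; first by exists 0%N.
  have [[m ym]|nm] := pselect (exists m, y_ m = y); last first.
    by exists N => n [e|/hN//]; case: nm; exists n.
  exists (maxn N m.+1) => n; rewrite leq_max => -[e|/hN->//].
  by rewrite (y_inj n m) ?e // ltnSn orbT.
by have := hN N (yF N); rewrite ltnn.
Qed.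

(** Over [p (tau y)] there are two vectors to link: the wave, whose image under [U] has mass near
    [q (sigma (p (tau y)))], and [delta (tau y)], whose image has mass near [y]. Finiteness of the
    fibres of [p \o tau] gives the bound over each centre. *)
Lemma concentrated_inverse :
  exists m, forall y, mdist (q (sigma (p (tau y)))) y <= m.
Proof.
apply: (bounded_link UV X_lf (c := fun y => p (tau y))
  (y := fun y => q (sigma (p (tau y)))) (y' := id)
  (a := fun y => wave (p (tau y))) (b := fun y => delta R (tau y))
  (rho := r) (r := r2) (k := 16^-1)).
- by rewrite invr_gt0.
- by move=> y i; exact: wave_supp.
- move=> y i h; rewrite deltaE; case: eqP => // ik.
  by move: h; rewrite ik mdistxx ltNge r_ge0.
- by [].
- by move=> y; rewrite l2norm_delta.
- by move=> y; exact: wave_mass.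
- move=> y; apply: le_trans (tauP y); lra.
- move=> x; have [m hm] := finite_bound (fun y => mdist (q (sigma x)) y)
    (finite_concentration_fiber x).
  by exists m => y yx; rewrite yx; exact: hm.
Qed.

End ConcentrationMaps.

Section MainRigidity.
Variables (R : realType) (X Y : metricType R) (I J : choiceType).
Variables (p : I -> X) (q : J -> Y) (i_ : X -> I) (j_ : Y -> J).
Hypothesis i_K : cancel i_ p.
Hypothesis j_K : cancel j_ q.

Lemma ulf_finite_ball (Z : metricType R) : ulf Z ->
  forall (z : Z) (r : R), finite_set [set y | mdist z y <= r].
Proof.
move=> hZ z r; have r1 : 0 < `|r| + 1 by rewrite ltr_wpDl.
have [N hN] := hZ _ r1.
apply: (@sub_finite_set _ _ [set y | mdist z y <= `|r| + 1]).
  move=> y /= h; apply: le_trans h _.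
  by rewrite (le_trans (ler_norm _)) // lerDl.
exact: card_le_finite (hN z) (finite_II N).
Qed.

Lemma spatial_coarse_equivalence U V : ulf X -> ulf Y -> spatial p q U V ->
  coarsely_equivalent X Y.
Proof.
move=> /ulf_finite_ball Xf /ulf_finite_ball Yf UV.
have VU := spatial_sym UV.
have [r [r0 [sigma hs]]] := exists_concentrated UV i_K.
have [r2 [r20 [tau ht]]] := exists_concentrated VU j_K.
have [m hm] := concentrated_inverse UV Xf Yf r0 hs r20 ht.
have [m' hm'] := concentrated_inverse VU Yf Xf r20 ht r0 hs.
exists (q \o sigma); split; first split.
- exact: (concentrated_coarse UV Xf hs).
- move=> s s0; have s1 : 0 < s + 1 by rewrite addr_gt0.
  have [t t0 ht'] := concentrated_coarse VU Yf ht s1.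
  (* If the images were closer than [s + 1], applying [p \o tau] would bring [x] and [x'] within [t]
     plus two displacements of at most [m']. *)
  exists (`|m'| + `|m'| + t) => [|x x' xx'].
    by rewrite ltr_wpDl ?addr_ge0.
  have [h|h] := ltP (mdist (q (sigma x)) (q (sigma x'))) (s + 1); last first.
    by apply: lt_le_trans h; rewrite ltrDl.
  have /= h1 := ht' _ _ h.
  have h2 := hm' x; have h3 := hm' x'; rewrite metric_sym in h2.
  have h4 := metric_triangle x (p (tau (q (sigma x)))) x'.
  have h5 := metric_triangle (p (tau (q (sigma x))))
    (p (tau (q (sigma x')))) x'.
  have h6 := ler_norm m'; lra.
- by exists m => y; exists (p (tau y)); rewrite metric_sym; exact: hm.
Qed.

Lemma fibred_roe_rigid : ulf X -> ulf Y ->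
  star_isomorphic (fibred_roe_algebra p) (fibred_roe_algebra q) ->
  coarsely_equivalent X Y.
Proof.
move=> hX hY iso; have [[x _]|noX] := pselect (exists x : X, True).
  have [U [V UV]] := star_isomorphic_spatial (i_ x) iso.
  exact: spatial_coarse_equivalence hX hY UV.
(* If [X] is empty its algebra has a single element, whereas a point of [Y] yields two distinct
   rank-one operators. *)
have noY (y : Y) : False.
  have [Phi [[_ _ surj] _ _ _]] := iso.
  pose d := delta R (j_ y).
  have [a _ aE] := surj _ (fibred_roe_rank_one q d d).
  have [b _ bE] := surj _ (fibred_roe_rank_one q 0 d).
  have ab : a = b.
    by apply/funext => u; apply: ell2_eqP => i; case: noX; exists (p i).
  have : rank_one d d d (j_ y) = rank_one 0 d d (j_ y) by rewrite -aE -bE ab.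
  rewrite /rank_one scaler0 l2dot_self nsq_delta scale1r deltaE eqxx => /eqP.
  by rewrite oner_eq0.
exists (fun x : X => False_rect Y (noX (ex_intro _ x Logic.I))).
split; first split.
- by move=> s s0; exists 1 => // x; case: noX; exists x.
- by move=> s s0; exists 1 => // x; case: noX; exists x.
- by exists 0 => y; case: (noY y).
Qed.

End MainRigidity.

Lemma uniform_roe_algebraE (R : realType) (X : metricType R) :
  uniform_roe_algebra (X := X) = fibred_roe_algebra (id : X -> X).
Proof.
rewrite /uniform_roe_algebra /fibred_roe_algebra; congr op_closure.
apply/seteqP; split=> a [ba fa] //; split=> // x y.
rewrite (_ : op_entry _ _ _ _ =
  rank_one (a (delta R x) y *: delta R y) (delta R x)).
  exact: compact_rank_one.
apply/funext => u; rewrite /op_entry /= /rank_one l2dot_delta.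
rewrite -[_ @^-1` [set x]]/[set x] -[_ @^-1` [set y]]/[set y] !mask_set1.
by rewrite (linZ ba.1) ell2ZE scalerA.
Qed.

Theorem theorem1p6 (R : realType) (X : metricType R) (X_ulf : ulf X) :
  [\/ [/\ sparse X, fibred_coarse_embedding X & coarse_baum_connes X],
      exists (Gamma : groupType) (S : set Gamma) (N : nat -> set Gamma),
        [/\ finite_generating S, residually_finite Gamma, is_box_space S N X,
            exists (V : completeNormedModType R) (f : Gamma -> V),
              property_H V /\
              coarse_embedding (@word_dist R Gamma S) (fun u v => `|u - v|) f &
            coarse_baum_connes X]
    | exists Gamma : groupType, is_group_with_proper_metric Gamma X /\
        baum_connes_with_coefficients R (group_groupoid Gamma)] ->
  roe_rigid X /\ uniform_roe_rigid X.
Proof.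
move=> _; split=> Y Y_ulf.
  (* [roe_algebra] unfolds to the fibred algebra of [fst]; the section selects the first basis
     vector of each fibre. *)
  exact: (fibred_roe_rigid (i_ := fun x => (x, 0%N)) (j_ := fun y => (y, 0%N))).
rewrite !uniform_roe_algebraE.
exact: (fibred_roe_rigid (i_ := id) (j_ := id)).
Qed.
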